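(* Let $X \subset \mathbb R^n$ be a regular convex set such that both $X$ and its polar $X^{\circ}$ are bounded. Let $f$ be a projectively self-concordant barrier on $X$. Then the dual function $f_*$ is defined on the whole interior of $-X^{\circ}$ and is a projectively self-concordant barrier on $-X^{\circ}$. The map $x \mapsto p = -\frac{f'(x)}{1 + \langle f'(x),x \rangle}$ is a bijection between the interiors of $X$ and $-X^{\circ}$.
   Context: A regular convex set $X \subset \mathbb R^n$ is a closed convex set with non-empty interior $X^o$ containing no lines; $\partial X$ is its boundary. A projectively self-concordant barrier on $X$ with parameter $\gamma \geq 0$ is a $C^3$ function $f: X^o \to \mathbb R$ such that: (1) $f''(x) - f'(x)f'(x)^T \succ 0$ (positive definite) for all $x \in X^o$; (2) $\lim_{x \to\partial X} f(x) = +\infty$, i.e. $f(x_k)\to+\infty$ whenever $x_k \in X^o$ converges to a point of $\partial X$; (3) $|f'''(x)[h,h,h] - 6f''(x)[h,h]f'(x)[h] + 4(f'(x)[h])^3| \leq 2\gamma(f''(x)[h,h] - (f'(x)[h])^2)^{3/2}$ for all $x \in X^o$, $h \in \mathbb R^n$. A function is called a projectively self-concordant barrier if it is one for some parameter $\gamma\ge0$. The polar of $X$ is $X^{\circ} = \{ p \in \mathbb R^n \mid \langle x,p \rangle \leq 1\ \forall\ x \in X \}$. The dual function of $f$ is $f_*(p) = -\min_{x \in X^o}\left(f(x) + \log(1 + \langle x,p \rangle)\right)$; its domain of definition consists of all $p \in \mathbb R^n$ such that the function $q_p(x) = f(x) + \log(1 + \langle x,p \rangle)$ is defined on all of $X^o$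 (i.e. $1+\langle x,p\rangle>0$ for all $x\in X^o$) and has a critical point in $X^o$. *)

(* Defs.v *)
From HB Require Import structures.
From mathcomp Require Export all_boot all_order all_algebra.
From mathcomp Require Export all_classical all_reals all_analysis.
Export Order.TTheory GRing.Theory Num.Theory.
Export numFieldNormedType.Exports.
#[export] Set Implicit Arguments.
#[export] Unset Strict Implicit.
#[export] Unset Printing Implicit Defensive.
Local Open Scope classical_set_scope.
Local Open Scope ring_scope.

(* Points, directions and gradients are all row vectors; the norm that 'rV[R]_n
   carries is the sup norm, which is only used through its topology and its
   bounded sets. *)

Definition dot (R : realType) (n : nat) (x p : 'rV[R]_n) : R :=
  \sum_(i < n) x 0 i * p 0 i.

Definition boundary (R : realType) (n : nat) (X : set 'rV[R]_n) :
  set 'rV[R]_n := closure X `\` X°.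

Definition contains_line (R : realType) (n : nat) (X : set 'rV[R]_n) : Prop :=
  exists x v : 'rV[R]_n, v != 0 /\ forall t : R, X (x + t *: v).

Definition regular_convex (R : realType) (n : nat) (X : set 'rV[R]_n) : Prop :=
  [/\ closed X, convex_set X, X° !=set0 & ~ contains_line X].

Definition polar (R : realType) (n : nat) (X : set 'rV[R]_n) :
  set 'rV[R]_n := [set p | forall x, X x -> dot x p <= 1].

(* [C_on k U f]: [f] is of class C^k on the open set [U]. In finite dimension
   the Frechet derivative is C^k iff each of its values [x |-> 'D_v f x] is. *)
Fixpoint C_on (R : realType) (n k : nat) (U : set 'rV[R]_n)
    (f : 'rV[R]_n -> R) : Prop :=
  match k with
  | 0 => forall x, U x -> {for x, continuous f}
  | k'.+1 => (forall x, U x -> differentiable f x) /\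
             (forall v : 'rV[R]_n, C_on k' U ('D_v f))
  end.

(* f'(x)[h], f''(x)[h,h] and f'''(x)[h,h,h] *)
Definition D1 (R : realType) (n : nat) (f : 'rV[R]_n -> R) (x h : 'rV[R]_n) : R
  := 'D_h f x.
Definition D2 (R : realType) (n : nat) (f : 'rV[R]_n -> R) (x h : 'rV[R]_n) : R
  := 'D_h ('D_h f) x.
Definition D3 (R : realType) (n : nat) (f : 'rV[R]_n -> R) (x h : 'rV[R]_n) : R
  := 'D_h ('D_h ('D_h f)) x.

Definition grad (R : realType) (n : nat) (f : 'rV[R]_n -> R) (x : 'rV[R]_n) :
  'rV[R]_n := \row_(i < n) 'D_(delta_mx 0 i) f x.

(* [f] is a total function, but only its values on the open set [X°] matter. *)
Definition psc_barrier_with (R : realType) (n : nat) (gamma : R)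
    (X : set 'rV[R]_n) (f : 'rV[R]_n -> R) : Prop :=
  [/\ C_on 3 X° f,
      forall x h : 'rV[R]_n, X° x -> h != 0 -> 0 < D2 f x h - D1 f x h ^+ 2,
      forall (x : nat -> 'rV[R]_n) (y : 'rV[R]_n),
        (forall k, X° (x k)) -> boundary X y -> x k @[k --> \oo] --> y ->
        f (x k) @[k --> \oo] --> +oo%R &
      forall x h : 'rV[R]_n, X° x ->
        `|D3 f x h - 6 * D2 f x h * D1 f x h + 4 * D1 f x h ^+ 3| <=
        2 * gamma * (D2 f x h - D1 f x h ^+ 2) `^ (3 / 2)].

Definition psc_barrier (R : realType) (n : nat) (X : set 'rV[R]_n)
    (f : 'rV[R]_n -> R) : Prop :=
  regular_convex X /\ exists2 gamma : R, 0 <= gamma & psc_barrier_with gamma X f.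

Definition dual_q (R : realType) (n : nat) (f : 'rV[R]_n -> R)
    (p x : 'rV[R]_n) : R := f x + ln (1 + dot x p).

Definition dual_dom (R : realType) (n : nat) (X : set 'rV[R]_n)
    (f : 'rV[R]_n -> R) : set 'rV[R]_n :=
  [set p | (forall x, X° x -> 0 < 1 + dot x p) /\
           exists2 x, X° x & is_diff x (dual_q f p) (fun=> 0)].

Definition is_minimum (R : realType) (A : set R) (m : R) : Prop :=
  A m /\ lbound A m.

(* [get] returns a junk value when no minimum exists. *)
Definition dual_fun (R : realType) (n : nat) (X : set 'rV[R]_n)
    (f : 'rV[R]_n -> R) (p : 'rV[R]_n) : R :=
  - get (is_minimum (dual_q f p @` X°)).

(* Main.v *)
From HB Require Import structures.
Require Import Defs.
From mathcomp Require Import ring lra.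
Local Open Scope classical_set_scope.
Local Open Scope ring_scope.

(* Put [u = exp (- f)] and [w = exp (- F)], where [F] is the dual function.
   Condition (1) says that [u] is strictly concave, and [w p] is the minimum of
   [(1 + <x, p>) / u x]. The stationarity condition reads
   [p = u' x / (u x - <u' x, x>)], so this map is a bijection by strict
   concavity, and its inverse [x p] is C^2 because its Jacobian is invertible.
   Along the duality one has [w u'(x) = p] and [u w'[h] = <x, h>];
   differentiating both twice, with [v = x'(p)[h]], gives
   [w''[h,h] / w = u''[v,v] / u], and the cubic form of condition (3) for [F] at
   [h] is minus that for [f] at [v], so that [F] has the same parameter. The
   divergence of [F] at the boundary means that [u] has infinite slope at the
   boundary of [X], which follows from condition (3). *)

(** * Directional derivatives *)

(** The substitution is natural because [f'' - f' f'^T = - u'' / u], while the cubic expression of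
    condition (3) equals [- (u''' / u + 3 u'' u' / u ^ 2)]: the two sides of the duality are then
    compared through [u] and [w] alone. Boundedness of [X] and of its polar together put the origin
    inside [X], and compactness of [X] makes the minimum defining [w] attained.

    The obstacle is the divergence of [F]. At a boundary point [p] of the negated polar some [y] in
    [X] has [<y, p> = -1], and near [p] the value of [w] is controlled by the quotients
    [(1 - t) / u (t y)]. That [u] tends to 0 does not make them small: [u = 1 - x ^ 2] on [[-1, 1]]
    is strictly concave and vanishes at the ends, but with finite slope, and its [F] stays below
    [ln 2]. Condition (3) rules this out through a differential inequality along the segment from 0
    to [y].

    The inverse [x p] exists globally, by maximisation, and is continuous by compactness. Only its
    derivatives have to be found, and the Jacobian serves for nothing else. *)

Section Differentials.
Context {R : realType} {V W : normedModType R}.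
Implicit Types (f g : V -> W) (x v : V).

Lemma is_diff_eps f x (df : {linear V -> W}) : continuous df ->
  (forall e : R, 0 < e ->
    \forall h \near (0 : V), `|f (h + x) - f x - df h| <= e * `|h|) ->
  is_diff x f df.
Proof.
move=> dfc H; have E : f \o shift x = cst (f x) + df +o_ (0 : V) id.
  apply/eqaddoP => e e0; near=> h.
  rewrite /= !fctE /= opprD addrA; near: h; exact: H.
have dE := diff_unique dfc E.
by split => //; apply/diff_locallyP; rewrite dE.
Unshelve. all: by end_near. Qed.

Lemma differentiable_eps f x : differentiable f x -> forall e : R, 0 < e ->
  \forall h \near (0 : V), `|f (h + x) - f x - 'd f x h| <= e * `|h|.
Proof.
move=> /diff_locally /eqaddoP H e e0; have := H e e0.
by apply: filter_app; near=> h; rewrite /= !fctE /= opprD addrA.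
Unshelve. all: by end_near. Qed.

Lemma near_eq_differentiable f g x :
  (\near x, f x = g x) -> differentiable f x -> differentiable g x.
Proof.
move=> fg df; suff [] : is_diff x g ('d f x) by [].
apply: (@is_diff_eps g x ('d f x)) => [|e e0]; first exact: diff_continuous.
have := differentiable_eps df e0; apply: filter_app.
have : \forall h \near (0 : V), f (h + x) = g (h + x).
  have := fg; rewrite (near_shift 0 x) /=; apply: filter_app; near=> h.
  by rewrite /= subr0.
apply: filter_app; near=> h => ->.
by rewrite (nbhs_singleton fg).
Unshelve. all: by end_near. Qed.

Lemma is_derive_line f x v (t : R) : derivable f (x + t *: v) v ->
  is_derive t 1 (fun s => f (x + s *: v)) ('D_v f (x + t *: v)).
Proof.
have E : (fun h : R => h^-1 *: (((fun s => f (x + s *: v)) \o shift t) h%:A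
     - f (x + t *: v))) =
   (fun h => h^-1 *: ((f \o shift (x + t *: v)) (h *: v) - f (x + t *: v))).
  apply/funext => h /=; rewrite [h%:A]mulr1.
  by rewrite scalerDl addrCA.
by move=> d; split; rewrite /derivable /derive E.
Qed.

End Differentials.

Section ScalarRules.
Context {R : realType} {V : normedModType R}.
Implicit Types (f : V -> R) (x v : V).

Lemma differentiable_comp1 (g : R -> R) f x (dg : R) :
  differentiable f x -> is_derive (f x) 1 g dg -> differentiable (g \o f) x.
Proof.
move=> df dgf; apply: differentiable_comp => //.
by apply/derivable1_diffP; exact: ex_derive.
Qed.

Lemma derive_comp1 (g : R -> R) f x v (dg : R) :
  differentiable f x -> is_derive (f x) 1 g dg ->
  'D_v (g \o f) x = dg * 'D_v f x.
Proof.
move=> df dgf; have gd : differentiable g (f x).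
  by apply/derivable1_diffP; exact: ex_derive.
rewrite deriveE; last exact: differentiable_comp.
rewrite diff_comp//= deriveE// diff1E// derive1E.
by rewrite (@derive_val _ _ _ _ _ _ _ dgf) mulrC.
Qed.

End ScalarRules.

Section VectorComposition.
Context {R : realType} {V : normedModType R} {n : nat}.
Implicit Types (phi : V -> 'rV[R]_n) (g : 'rV[R]_n -> R).

Lemma differentiable_rV phi x :
  (forall i, differentiable (fun y => phi y 0 i) x) -> differentiable phi x.
Proof.
move=> H; have -> : phi = \sum_i (fun y => phi y 0 i *: delta_mx 0 i).
  by apply/funext => y; rewrite fct_sumE; exact: row_sum_delta.
by apply: differentiable_sum => i; exact: differentiableZl.
Qed.

Lemma derive_coordE g x (v : 'rV[R]_n) : differentiable g x ->
  'D_v g x = \sum_i v 0 i * 'D_(delta_mx 0 i) g x.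
Proof.
move=> dg; rewrite deriveE// {1}(row_sum_delta v) linear_sum /=.
by apply: eq_bigr => i _; rewrite linearZ /= deriveE.
Qed.

Lemma differentiable_comp_rV phi g x :
  (forall i, differentiable (fun y => phi y 0 i) x) ->
  differentiable g (phi x) -> differentiable (g \o phi) x.
Proof. by move=> H dg; apply: differentiable_comp => //; exact: differentiable_rV. Qed.

Lemma derive_comp_rV phi g x h :
  (forall i, differentiable (fun y => phi y 0 i) x) ->
  differentiable g (phi x) ->
  'D_h (g \o phi) x =
  \sum_i 'D_h (fun y => phi y 0 i) x * 'D_(delta_mx 0 i) g (phi x).
Proof.
move=> H dg; have dphi := differentiable_rV H.
rewrite deriveE; last exact: differentiable_comp.
rewrite diff_comp//= -deriveE//= -deriveE//= derive_coordE//.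
by apply: eq_bigr => i _; rewrite derive_mx ?mxE//; exact: diff_derivable.
Qed.

End VectorComposition.

(** * Functions of class C^k *)

Section Ck.
Context {R : realType} {n : nat}.
Variable U : set 'rV[R]_n.
Hypothesis oU : open U.
Implicit Types (f g : 'rV[R]_n -> R) (x v : 'rV[R]_n) (k : nat).

Lemma near_open (P : 'rV[R]_n -> Prop) x :
  (forall y, U y -> P y) -> U x -> \forall y \near x, P y.
Proof.
move=> H Ux; have : nbhs x U by exact: open_nbhs_nbhs.
by apply: filterS.
Qed.

Lemma C_on_ext k f g :
  (forall x, U x -> f x = g x) -> C_on k U f -> C_on k U g.
Proof.
elim: k f g => [|k IH] f g fg /=.
  move=> H x Ux; have fgx := near_open fg Ux.
  rewrite /prop_for /continuous_at -(fg x Ux).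
  apply: cvg_trans; last exact: (H _ Ux).
  exact: (@near_eq_cvg _ _ (nbhs x) (nbhs_filter x) f g fgx).
move=> [df Df]; split.
  by move=> x Ux; apply: near_eq_differentiable (near_open fg Ux) (df _ Ux).
move=> v; apply: IH (Df v) => x Ux.
by apply: near_eq_derive; exact: near_open fg Ux.
Qed.

Lemma C_on_diff k f x : C_on k.+1 U f -> U x -> differentiable f x.
Proof. by move=> [+ _]; apply. Qed.

Lemma C_on_derive k f v : C_on k.+1 U f -> C_on k U ('D_v f).
Proof. by move=> [_ +]; apply. Qed.

Lemma C_on_continuous k f x : C_on k U f -> U x -> {for x, continuous f}.
Proof.
case: k => [|k] H Ux; first exact: H.
by apply: differentiable_continuous; exact: C_on_diff H Ux.
Qed.

Lemma C_onS k f : C_on k.+1 U f -> C_on k U f.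
Proof.
elim: k f => [|k IH] f H; first by move=> x Ux; exact: C_on_continuous H Ux.
split=> [x Ux|v]; first exact: C_on_diff H Ux.
by apply: IH; exact: C_on_derive.
Qed.

(** The derivative formulas below hold on [U] only, whereas [C_on] speaks of the total function
    ['D_v f]; openness of [U] makes agreement on [U] enough. *)
Lemma C_on_intro k f (df : 'rV[R]_n -> 'rV[R]_n -> R) :
  (forall x, U x -> differentiable f x) ->
  (forall v x, U x -> 'D_v f x = df v x) ->
  (forall v, C_on k U (df v)) -> C_on k.+1 U f.
Proof.
move=> H1 H2 H3; split=> // v; apply: C_on_ext (H3 v) => x Ux.
by rewrite H2.
Qed.

Lemma C_on_cst k (a : R) : C_on k U (fun=> a).
Proof.
elim: k a => [|k IH] a; first by move=> x _; exact: cst_continuous.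
apply: (@C_on_intro _ _ (fun _ _ => 0)) => [x _|v x _|v].
- exact: differentiable_cst.
- exact: derive_cst.
- exact: IH.
Qed.

Lemma C_on_coord k i : C_on k U (fun x => x 0 i).
Proof.
case: k => [|k]; first by move=> x _; exact: coord_continuous.
apply: (@C_on_intro _ _ (fun v _ => v 0 i)) => [x _|v x _|v].
- exact: differentiable_coord.
- rewrite deriveE; last exact: differentiable_coord.
  pose c := fun y : 'rV[R]_n => y 0 i.
  have lc : linear c by move=> a y z; rewrite /c !mxE.
  pose cM := GRing.isLinear.Build _ _ _ _ _ lc.
  pose cL : {linear _ -> _} := HB.pack c cM.
  rewrite -/c -[c]/(cL : _ -> _) diff_lin//.
  exact: coord_continuous.
- exact: C_on_cst.
Qed.

Lemma C_onD k f g : C_on k U f -> C_on k U g -> C_on k U (fun x => f x + g x).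
Proof.
elim: k f g => [|k IH] f g Cf Cg.
  move=> x Ux; exact: (continuousD (Cf x Ux) (Cg x Ux)).
apply: (@C_on_intro _ _ (fun v x => 'D_v f x + 'D_v g x)) => [x Ux|v x Ux|v].
- by apply: differentiableD; [exact: C_on_diff Cf Ux|exact: C_on_diff Cg Ux].
- by apply: deriveD; apply: diff_derivable;
    [exact: C_on_diff Cf Ux|exact: C_on_diff Cg Ux].
- by apply: IH; exact: C_on_derive.
Qed.

Lemma C_onM k f g : C_on k U f -> C_on k U g -> C_on k U (fun x => f x * g x).
Proof.
elim: k f g => [|k IH] f g Cf Cg.
  by move=> x Ux; exact: (continuousM (Cf x Ux) (Cg x Ux)).
apply: (@C_on_intro _ _ (fun v x => f x * 'D_v g x + g x * 'D_v f x))
  => [x Ux|v x Ux|v].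
- by apply: differentiableM; [exact: C_on_diff Cf Ux|exact: C_on_diff Cg Ux].
- by apply: deriveM; apply: diff_derivable;
    [exact: C_on_diff Cf Ux|exact: C_on_diff Cg Ux].
- by apply: C_onD; apply: IH; do ?exact: C_on_derive; exact: C_onS.
Qed.

Lemma C_onN k f : C_on k U f -> C_on k U (fun x => - f x).
Proof.
move=> Cf; have := C_onM (C_on_cst k (-1)) Cf.
by apply: C_on_ext => x _; rewrite mulN1r.
Qed.

Lemma C_on_sum k (I : Type) (r : seq I) (P : pred I) (F : I -> 'rV[R]_n -> R) :
  (forall i, C_on k U (F i)) -> C_on k U (fun x => \sum_(i <- r | P i) F i x).
Proof.
move=> H; elim: r => [|i r IH].
  by apply: C_on_ext (C_on_cst k 0) => x _; rewrite big_nil.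
have [Pi|Pi] := boolP (P i).
  by apply: C_on_ext (C_onD (H i) IH) => x _; rewrite big_cons Pi.
by apply: C_on_ext IH => x _; rewrite big_cons (negbTE Pi).
Qed.

Lemma C_on_prod k (I : Type) (r : seq I) (P : pred I) (F : I -> 'rV[R]_n -> R) :
  (forall i, C_on k U (F i)) -> C_on k U (fun x => \prod_(i <- r | P i) F i x).
Proof.
move=> H; elim: r => [|i r IH].
  by apply: C_on_ext (C_on_cst k 1) => x _; rewrite big_nil.
have [Pi|Pi] := boolP (P i).
  by apply: C_on_ext (C_onM (H i) IH) => x _; rewrite big_cons Pi.
by apply: C_on_ext IH => x _; rewrite big_cons (negbTE Pi).
Qed.

Lemma C_on_det k m (M : 'rV[R]_n -> 'M[R]_m) :
  (forall i j, C_on k U (fun x => M x i j)) -> C_on k U (fun x => \det (M x)).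
Proof.
move=> H; apply: C_on_sum => s; apply: C_onM; first exact: C_on_cst.
by apply: C_on_prod => i.
Qed.

Lemma C_onV k f : (forall x, U x -> f x != 0) -> C_on k U f ->
  C_on k U (fun x => (f x)^-1).
Proof.
move=> f0; elim: k => [|k IH] Cf.
  by move=> x Ux; apply: continuousV; [exact: f0|exact: Cf].
apply: (@C_on_intro _ _ (fun v x => - ((f x)^-1 * (f x)^-1) * 'D_v f x))
  => [x Ux|v x Ux|v].
- by apply: differentiableV; [exact: C_on_diff Cf Ux|exact: f0].
- rewrite deriveV ?f0//; last exact/diff_derivable/(C_on_diff Cf).
  by rewrite -expr2 exprVn.
- apply: C_onM; last exact: C_on_derive.
  have CV := IH (C_onS Cf).
  by apply: C_onN; apply: C_onM.
Qed.

(** Cramer's rule: an entry is a cofactor, polynomial in the entries of [M x], divided by the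
    determinant. *)
Lemma C_on_invmx k m (M : 'rV[R]_n -> 'M[R]_m) i j :
  (forall x, U x -> M x \in unitmx) ->
  (forall i j, C_on k U (fun x => M x i j)) ->
  C_on k U (fun x => invmx (M x) i j).
Proof.
move=> uM H.
have : C_on k U (fun x => (\det (M x))^-1 * \adj (M x) i j).
  apply: C_onM.
    apply: C_onV; last exact: C_on_det.
    by move=> x Ux; have := uM x Ux; rewrite unitmxE unitfE.
  apply: (@C_on_ext _ (fun x => (-1) ^+ (j + i) * \det (row' j (col' i (M x))))).
    by move=> x _; rewrite [RHS]mxE.
  apply: C_onM; first exact: C_on_cst.
  apply: C_on_det => a b; apply: C_on_ext (H (lift j a) (lift i b)) => x _.
  by rewrite !mxE.
by apply: C_on_ext => x Ux; rewrite /invmx (uM _ Ux) [RHS]mxE.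
Qed.

Lemma C_on_exp k f : C_on k U f -> C_on k U (fun x => expR (f x)).
Proof.
elim: k => [|k IH] Cf.
  by move=> x Ux; apply: continuous_comp; [exact: Cf|exact: continuous_expR].
apply: (@C_on_intro _ _ (fun v x => expR (f x) * 'D_v f x)) => [x Ux|v x Ux|v].
- exact: (differentiable_comp1 (C_on_diff Cf Ux) (is_derive_expR (f x))).
- exact: (derive_comp1 _ (C_on_diff Cf Ux) (is_derive_expR (f x))).
- by apply: C_onM; [apply: IH; exact: C_onS|exact: C_on_derive].
Qed.

Lemma C_on_ln k f : (forall x, U x -> 0 < f x) -> C_on k U f ->
  C_on k U (fun x => ln (f x)).
Proof.
move=> f0; case: k => [|k] Cf.
  move=> x Ux; apply: continuous_comp; first exact: Cf.
  by apply: continuous_ln; exact: f0.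
have dln x : U x -> is_derive (f x) 1 (@ln R) (f x)^-1.
  by move=> Ux; apply: is_derive1_ln; exact: f0.
apply: (@C_on_intro _ _ (fun v x => (f x)^-1 * 'D_v f x)) => [x Ux|v x Ux|v].
- exact: (differentiable_comp1 (C_on_diff Cf Ux) (dln _ Ux)).
- exact: (derive_comp1 _ (C_on_diff Cf Ux) (dln _ Ux)).
- apply: C_onM; last exact: C_on_derive.
  by apply: C_onV; [move=> x Ux; rewrite gt_eqF// f0|exact: C_onS].
Qed.

Lemma cvg_rV (phi : 'rV[R]_n -> 'rV[R]_n) x :
  (forall i, {for x, continuous (fun y => phi y 0 i)}) -> {for x, continuous phi}.
Proof.
move=> H; apply/(cvgrPdist_lt (FF := nbhs_filter x)) => /= e e0.
have : \forall y \near x, forall i, `|phi x 0 i - phi y 0 i| < e.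
  apply: (@filter_forall _ _ (fun i y => `|phi x 0 i - phi y 0 i| < e) _
    (nbhs_filter x)) => i.
  by have /(cvgrPdist_lt (FF := nbhs_filter x))/(_ e e0) := H i.
apply: filterS => y Hy.
rewrite [X in X < _]/Num.Def.normr /= mx_normrE; apply/bigmax_ltP; split=> //.
by move=> [i j] _ /=; rewrite !mxE ord1; exact: Hy.
Qed.

Lemma C_on_comp k (Y : set 'rV[R]_n) (phi : 'rV[R]_n -> 'rV[R]_n) f :
  open Y -> (forall x, U x -> Y (phi x)) ->
  (forall i, C_on k U (fun x => phi x 0 i)) -> C_on k Y f ->
  C_on k U (fun x => f (phi x)).
Proof.
move=> oY UY; elim: k f => [|k IH] f Cphi Cf.
  move=> x Ux; apply: continuous_comp; last by apply: Cf; exact: UY.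
  by apply: cvg_rV => i; exact: Cphi.
have dphi x : U x -> forall i, differentiable (fun y => phi y 0 i) x.
  by move=> Ux i; exact: C_on_diff (Cphi i) Ux.
have df x : U x -> differentiable f (phi x).
  by case: Cf => Cf _ Ux; apply: Cf; exact: UY.
apply: (@C_on_intro _ _ (fun v x =>
  \sum_i 'D_v (fun y => phi y 0 i) x * 'D_(delta_mx 0 i) f (phi x)))
  => [x Ux|v x Ux|v].
- by apply: differentiable_comp_rV; [exact: dphi|exact: df].
- by apply: derive_comp_rV; [exact: dphi|exact: df].
- apply: C_on_sum => i; apply: C_onM; first exact: C_on_derive.
  apply: (IH ('D_(delta_mx 0 i) f)); first by move=> j; exact: C_onS.
  by case: Cf => _; apply.
Qed.

End Ck.

(** * Regularity of inverse maps *)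

Section InverseMap.
Context {R : realType} {n : nat}.
Implicit Types (P Q : 'rV[R]_n -> 'rV[R]_n) (x p v : 'rV[R]_n).

Lemma mulmxr_continuous (M : 'M[R]_n) :
  continuous (mulmxr M : 'rV[R]_n -> 'rV[R]_n).
Proof.
move=> x; apply: cvg_rV => i.
have oT : open [set: 'rV[R]_n] := openT.
have : C_on 0 setT (fun y : 'rV[R]_n => (y *m M) 0 i).
  apply: (C_on_ext oT (f := fun y => \sum_j y 0 j * M j i)).
    by move=> y _; rewrite mxE.
  apply: (C_on_sum oT) => j.
  exact: (C_onM oT (C_on_coord oT _ _) (C_on_cst oT _ _)).
by move=> /(_ x I).
Qed.

(** Put [y = Q q - Q p] and [N = invmx M]. Differentiability of [P] gives [q - p = y M + o(y)],
    hence [y = (q - p) N + o(y)]. Bounding the error by [|y| / 2] first yields [|y| = O(|q - p|)],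
    which turns [o(y)] into [o(q - p)]. *)
Lemma is_diff_inverse P Q (M : 'M[R]_n) p :
  {for p, continuous Q} -> (\forall q \near p, P (Q q) = q) ->
  M \in unitmx -> is_diff (Q p) P (mulmxr M) ->
  is_diff p Q (mulmxr (invmx M)).
Proof.
move=> cQ PQ uM dP; apply: is_diff_eps; first exact: mulmxr_continuous.
move=> e e0; pose N := invmx M.
have [C C0 HC] := linear_lipschitz (@mulmxr_continuous N).
(* The first entry gives [C e1 <= 1 / 2], so that the error can be absorbed; the second makes
   [C e1 (2 C |q - p|)] at most [e |q - p|]. *)
pose e1 := Num.min (2 * C)^-1 (e / (2 * C ^+ 2)).
have e10 : 0 < e1.
  by rewrite lt_min invr_gt0 divr_gt0// mulr_gt0// exprn_gt0.
have dP1 : differentiable P (Q p) by exact: ex_diff.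
have dE : 'd P (Q p) = mulmxr M :> (_ -> _) by exact: diff_val.
have near1 : \forall q \near p,
    `|P (Q q) - P (Q p) - (Q q - Q p) *m M| <= e1 * `|Q q - Q p|.
  have := differentiable_eps dP1 e10; rewrite dE => K.
  have : \forall y \near Q p, `|P y - P (Q p) - (y - Q p) *m M| <= e1 * `|y - Q p|.
    rewrite (near_shift 0 (Q p)); apply: filterS K => y /=.
    by rewrite subr0 addrK.
  by move=> /cQ.
have PQp : P (Q p) = p by exact: (nbhs_singleton PQ).
have near2 : \forall q \near p, `|Q q - Q p - (q - p) *m N| <= e * `|q - p|.
  apply: filterS2 near1 PQ => q + PQq; rewrite PQq PQp => H.
  set y := Q q - Q p in H *.
  have E : (q - p - y *m M) *m N = (q - p) *m N - y.
    by rewrite mulmxBl -mulmxA mulmxV// mulmx1.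
  have K : `|(q - p) *m N - y| <= C * (e1 * `|y|).
    by rewrite -E (le_trans (HC _))// ler_pM2l.
  have e1C : C * e1 <= 2^-1.
    apply: (@le_trans _ _ (C * (2 * C)^-1)).
      by rewrite ler_pM2l// ge_min lexx.
    by rewrite invfM mulrCA divff ?gt_eqF// mulr1.
  have yq : `|y| <= 2 * C * `|q - p|.
    have := ler_normD ((q - p) *m N) (y - (q - p) *m N).
    rewrite addrC subrK => K2; have K3 := HC (q - p).
    rewrite (distrC y) in K2.
    have K4 : C * (e1 * `|y|) <= 2^-1 * `|y| by rewrite mulrA ler_wpM2r.
    rewrite /= in K3; move: K K2 K3 K4; move: `|y| `|_ *m N| `|_ - y| => a b c.
    by move: (C * (e1 * a)) => m; lra.
  rewrite distrC (le_trans K)// mulrA (le_trans (ler_wpM2l _ yq))//.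
    by rewrite mulr_ge0// ltW.
  have e1e : e1 * (2 * C ^+ 2) <= e.
    by rewrite -ler_pdivlMr ?mulr_gt0 ?exprn_gt0// ge_min lexx orbT.
  rewrite mulrA ler_wpM2r// (le_trans _ e1e)//.
  by rewrite le_eqVlt; apply/orP; left; apply/eqP; ring.
rewrite (near_shift p) /=; apply: filterS near2 => q /=.
by rewrite sub0r subrK.
Qed.

(** Vectors are rows, so this is the transpose of the usual Jacobian: it acts on a direction by
    multiplication on the right. *)
Definition jacmx P x : 'M[R]_n := \matrix_(i, j) 'D_(delta_mx 0 i) (fun y => P y 0 j) x.

Lemma is_diff_jacmx P x : (forall j, differentiable (fun y => P y 0 j) x) ->
  is_diff x P (mulmxr (jacmx P x)).
Proof.
move=> dP; have dP' := differentiable_rV dP; split=> //.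
apply/funext => v; rewrite -deriveE//.
rewrite derive_mx; last exact: diff_derivable.
apply/rowP => j; rewrite !mxE derive_coordE//.
by apply: eq_bigr => i _; rewrite mxE.
Qed.

Lemma derive_inverse P Q p h i :
  {for p, continuous Q} -> (\forall q \near p, P (Q q) = q) ->
  (forall j, differentiable (fun y => P y 0 j) (Q p)) ->
  jacmx P (Q p) \in unitmx ->
  differentiable (fun q => Q q 0 i) p /\
  'D_h (fun q => Q q 0 i) p = (h *m invmx (jacmx P (Q p))) 0 i.
Proof.
move=> cQ PQ dP uJ; have dQ := is_diff_inverse cQ PQ uJ (is_diff_jacmx dP).
have dQ' : differentiable Q p by exact: ex_diff.
split.
  apply: (@differentiable_comp _ _ _ _ Q (fun y => y 0 i)) => //.
  exact: differentiable_coord.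
have -> : (h *m invmx (jacmx P (Q p))) = 'D_h Q p by rewrite deriveE// diff_val.
by rewrite derive_mx ?mxE//; exact: diff_derivable.
Qed.

(** Bootstrap: the derivative of [Q] is the inverse Jacobian of [P] taken at [Q p], which is C^k as
    soon as [Q] is C^k and [P] is of class [k.+1]. The induction starts from the assumed continuity
    of [Q]. *)
Lemma C_on_inverse k (U Y : set 'rV[R]_n) P Q : open U -> open Y ->
  (forall p, Y p -> U (Q p)) -> (forall p, Y p -> P (Q p) = p) ->
  (forall i, C_on 0 Y (fun p => Q p 0 i)) ->
  (forall j, C_on k U (fun x => P x 0 j)) ->
  (forall x, U x -> jacmx P x \in unitmx) ->
  forall i, C_on k Y (fun p => Q p 0 i).
Proof.
move=> oU oY UQ PQ Q0 + uJ; elim: k => [//|k IH] CP i.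
have CQ := IH (fun j => C_onS (CP j)).
have cQ p : Y p -> {for p, continuous Q}.
  by move=> Yp; apply: cvg_rV => j; exact: Q0.
have dQ h p : Y p -> differentiable (fun q => Q q 0 i) p /\
    'D_h (fun q => Q q 0 i) p = (h *m invmx (jacmx P (Q p))) 0 i.
  move=> Yp; apply: derive_inverse.
  - exact: cQ.
  - exact: near_open PQ Yp.
  - by move=> j; exact: C_on_diff (CP j) (UQ _ Yp).
  - by apply: uJ; exact: UQ.
apply: (C_on_intro oY (df := fun h p => \sum_j h 0 j * invmx (jacmx P (Q p)) j i)).
- by move=> p Yp; have [] := dQ 0 p Yp.
- by move=> h p Yp; have [_ ->] := dQ h p Yp; rewrite mxE.
- move=> h; apply: C_on_sum => // j; apply: C_onM => //; first exact: C_on_cst.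
  apply: C_on_invmx => //; first by move=> p Yp; apply: uJ; exact: UQ.
  move=> a b.
  apply: (C_on_ext oY (f := fun p => 'D_(delta_mx 0 a) (fun y => P y 0 b) (Q p))).
    by move=> p _; rewrite mxE.
  exact: (C_on_comp oY oU UQ CQ (C_on_derive (delta_mx 0 a) (CP b))).
Qed.

End InverseMap.

(** * Symmetry of second derivatives *)

Section MeanValue.
Context {R : realType} {n : nat}.
Implicit Types (f : 'rV[R]_n -> R) (x v a b : 'rV[R]_n).

Lemma MVT0 (g dg : R -> R) (t : R) : 0 < t ->
  (forall s, 0 <= s <= t -> is_derive s 1 g (dg s)) ->
  exists2 s, 0 < s < t & g t - g 0 = dg s * t.
Proof.
move=> t0 H; have [||s] := @MVT R g dg 0 t t0.
- by move=> s; rewrite in_itv/= => /andP[s0 st]; apply: H; rewrite !ltW.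
- apply: derivable_within_continuous => s; rewrite in_itv /= => st.
  by have [] := H s st.
- by rewrite in_itv/= subr0 => st E; exists s.
Qed.

(** Mean value theorem twice, along [a] for the difference in direction [b] and then along [b]: the
    second difference is [t ^ 2] times the mixed derivative at a nearby point, and continuity of
    that derivative does the rest. *)
Lemma second_difference (U : set 'rV[R]_n) f x a b (e : R) :
  open U -> C_on 2 U f -> U x -> 0 < e ->
  exists2 d : R, 0 < d & forall t, 0 < t < d ->
  `|f (x + t *: a + t *: b) - f (x + t *: a) - f (x + t *: b) + f x
    - 'D_b ('D_a f) x * t ^+ 2| <= e * t ^+ 2.
Proof.
move=> oU Cf Ux e0; have Cfa := C_on_derive a Cf.
have Cfab : C_on 0 U ('D_b ('D_a f)) by exact: C_on_derive.
have /cvgrPdist_lt/(_ e e0) H := Cfab x Ux.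
have UH : nbhs x [set y | U y /\ `|'D_b ('D_a f) x - 'D_b ('D_a f) y| < e].
  by apply: filterI => //; exact: open_nbhs_nbhs.
have /nbhs_ballP[r /= r0 rH] := UH.
(* The added 1 keeps the quotient below meaningful when [a] and [b] both vanish. *)
have ab0 : 0 < `|a| + `|b| + 1.
  by rewrite ltr_pwDr// addr_ge0.
have inU t s1 s2 : 0 < t < r / (`|a| + `|b| + 1) -> 0 <= s1 <= t ->
    0 <= s2 <= t -> U (x + s1 *: a + s2 *: b) /\
   `|'D_b ('D_a f) x - 'D_b ('D_a f) (x + s1 *: a + s2 *: b)| < e.
  move=> /andP[t0 tr] /andP[s10 s1t] /andP[s20 s2t]; apply: rH.
  rewrite -ball_normE /= -addrA opprD addNKr normrN.
  rewrite ltr_pdivlMr// in tr; apply: le_lt_trans tr.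
  apply: le_trans (ler_normD _ _) _; rewrite !normrZ !ger0_norm//.
  rewrite !mulrDr -[leLHS]addr0 lerD ?mulr1 ?(ltW t0)//.
  by rewrite lerD// ler_wpM2r.
exists (r / (`|a| + `|b| + 1)); first by rewrite divr_gt0.
move=> t tr; have /andP[t0 _] := tr.
have t00 : 0 <= (0 : R) <= t by rewrite lexx ltW.
have ttt : 0 <= t <= t by rewrite lexx ltW.
have df y : U y -> differentiable f y by exact: C_on_diff Cf.
have dfa y : U y -> differentiable ('D_a f) y by exact: C_on_diff Cfa.
have [s st E1] : exists2 s, 0 < s < t &
   (f (x + t *: b + t *: a) - f (x + t *: a)) -
   (f (x + t *: b + 0 *: a) - f (x + 0 *: a)) =
   ('D_a f (x + t *: b + s *: a) - 'D_a f (x + s *: a)) * t.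
  apply: (@MVT0 (fun s => f (x + t *: b + s *: a) - f (x + s *: a))
    (fun s => 'D_a f (x + t *: b + s *: a) - 'D_a f (x + s *: a))) => // s st.
  apply: is_deriveB; apply: is_derive_line; apply: diff_derivable; apply: df.
    by rewrite addrAC; have [] := inU t s t tr st ttt.
  by have [] := inU t s 0 tr st t00; rewrite scale0r addr0.
have st' : 0 <= s <= t by case/andP: st => *; rewrite !ltW.
have D2f w : 0 <= w <= t -> is_derive w 1 (fun q => 'D_a f (x + s *: a + q *: b))
    ('D_b ('D_a f) (x + s *: a + w *: b)).
  move=> wt; apply: is_derive_line; apply: diff_derivable; apply: dfa.
  by have [] := inU t s w tr st' wt.
have [q qt E2] := MVT0 t0 D2f.
have qt' : 0 <= q <= t by case/andP: qt => *; rewrite !ltW.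
rewrite !scale0r !addr0 in E1 E2.
rewrite (addrAC x (t *: b)) (addrAC x (t *: b)) E2 in E1.
rewrite (_ : _ + f x = 'D_b ('D_a f) (x + s *: a + q *: b) * t ^+ 2); last first.
  rewrite expr2 mulrA -E1; ring.
rewrite -mulrBl normrM (ger0_norm (sqr_ge0 t)) ler_wpM2r ?sqr_ge0//.
by rewrite distrC ltW//; have [] := inU t s q tr st' qt'.
Qed.

(** The second difference is symmetric in [a] and [b], so for small [t] its quotient by [t ^ 2] lies
    within [e / 2] of both mixed derivatives. *)
Lemma derive_swap (U : set 'rV[R]_n) f x a b : open U -> C_on 2 U f -> U x ->
  'D_a ('D_b f) x = 'D_b ('D_a f) x.
Proof.
move=> oU Cf Ux; apply/eqP; rewrite eq_le; wlog suff : a b / 'D_a ('D_b f) x <= 'D_b ('D_a f) x.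
  by move=> H; apply/andP; split; exact: H.
apply/ler_addgt0Pr => e e0; have e20 : 0 < e / 2 by rewrite divr_gt0.
have [d1 d10 H1] := second_difference a b oU Cf Ux e20.
have [d2 d20 H2] := second_difference b a oU Cf Ux e20.
pose t := Num.min d1 d2 / 2.
have m0 : 0 < Num.min d1 d2 by rewrite lt_min d10.
have t0 : 0 < t by rewrite divr_gt0.
have tm : t < Num.min d1 d2 by rewrite gtr_pMr// invf_lt1// ltr1n.
move: (tm); rewrite lt_min => /andP[td1 td2].
have := H1 t; rewrite t0 td1 => /(_ isT); rewrite ler_norml => /andP[_ K1].
have := H2 t; rewrite t0 td2 => /(_ isT); rewrite ler_norml => /andP[K2 _].
rewrite -(ler_pM2r (exprn_gt0 2 t0)).
rewrite (addrAC x (t *: b)) in K2.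
move: K1 K2; move: ('D_b ('D_a f) x) ('D_a ('D_b f) x) => A B.
move: (f (x + t *: a + t *: b)) (f (x + t *: a)) (f (x + t *: b)) (f x) => p q r s.
move: (t ^+ 2) => t2 K1 K2; lra.
Qed.

End MeanValue.

(** * Convex sets and polars *)

Section Dot.
Context {R : realType} {n : nat}.
Implicit Types (x y z p q v : 'rV[R]_n).

Lemma dotC x p : dot x p = dot p x.
Proof. by apply: eq_bigr => i _; rewrite mulrC. Qed.

Lemma dotDl x y p : dot (x + y) p = dot x p + dot y p.
Proof. by rewrite -big_split; apply: eq_bigr => i _; rewrite mxE mulrDl. Qed.

Lemma dotZl a x p : dot (a *: x) p = a * dot x p.
Proof. by rewrite mulr_sumr; apply: eq_bigr => i _; rewrite mxE mulrA. Qed.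

Lemma dotNl x p : dot (- x) p = - dot x p.
Proof. by rewrite -scaleN1r dotZl mulN1r. Qed.

Lemma dotBl x y p : dot (x - y) p = dot x p - dot y p.
Proof. by rewrite dotDl dotNl. Qed.

Lemma dotDr x p q : dot x (p + q) = dot x p + dot x q.
Proof. by rewrite dotC dotDl !(dotC x). Qed.

Lemma dotZr a x p : dot x (a *: p) = a * dot x p.
Proof. by rewrite dotC dotZl (dotC x). Qed.

Lemma dotNr x p : dot x (- p) = - dot x p.
Proof. by rewrite dotC dotNl (dotC x). Qed.

Lemma dotBr x p q : dot x (p - q) = dot x p - dot x q.
Proof. by rewrite dotDr dotNr. Qed.

Lemma dot0l p : dot 0 p = 0.
Proof. by rewrite -(scale0r 0) dotZl mul0r. Qed.

Lemma dot0r p : dot p 0 = 0.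
Proof. by rewrite dotC dot0l. Qed.

Lemma dot_subZ (t : R) x y : dot (x - t *: y) (x - t *: y) =
  dot x x - 2 * t * dot y x + t * t * dot y y.
Proof. by rewrite !(dotBl, dotBr, dotZl, dotZr) (dotC x y); ring. Qed.

Lemma dotxx_ge0 x : 0 <= dot x x.
Proof. by apply: sumr_ge0 => i _; rewrite -expr2 sqr_ge0. Qed.

Lemma dotxx_gt0 x : x != 0 -> 0 < dot x x.
Proof.
move=> x0; rewrite lt_neqAle dotxx_ge0 andbT eq_sym; apply: contra x0.
rewrite psumr_eq0; last by move=> i _; rewrite -expr2 sqr_ge0.
move=> /allP H; apply/eqP/rowP => i; rewrite mxE.
have := H i (mem_index_enum _); rewrite -expr2 sqrf_eq0.
by move=> /eqP.
Qed.

Lemma coord_norm x i : `|x 0 i| <= `|x|.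
Proof.
rewrite [leRHS]/Num.Def.normr /= mx_normrE.
exact: (le_bigmax _ (fun j : 'I_1 * 'I_n => `|x j.1 j.2|) (0, i)).
Qed.

(** The sup norm bounds each of the [n] products, whence the factor [n]. *)
Lemma dot_norm_le x p : `|dot x p| <= n%:R * `|x| * `|p|.
Proof.
apply: le_trans (ler_norm_sum _ _ _) _.
apply: (@le_trans _ _ (\sum_(i < n) `|x| * `|p|)); last first.
  by rewrite sumr_const card_ord -mulrA mulr_natl.
by apply: ler_sum => i _; rewrite normrM ler_pM// coord_norm.
Qed.

Lemma dot_continuous : continuous (fun z : 'rV[R]_n * 'rV[R]_n => dot z.1 z.2).
Proof.
move=> z; apply: (cvg_big (op := +%R) (x0 := 0 : R) (P := xpredT) _
  (F := nbhs z) (Ff := fun i (y : 'rV[R]_n * 'rV[R]_n) => y.1 0 i * y.2 0 i)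
  (Fa := fun i => z.1 0 i * z.2 0 i)).
  exact: add_continuous.
move=> i _; apply: cvgM.
  apply: (@continuous_comp _ _ _ fst (fun y : 'rV[R]_n => y 0 i) z).
    exact: cvg_fst.
  exact: coord_continuous.
apply: (@continuous_comp _ _ _ snd (fun y : 'rV[R]_n => y 0 i) z).
  exact: cvg_snd.
exact: coord_continuous.
Qed.

Lemma dot_cvg (f g : 'rV[R]_n -> 'rV[R]_n) x :
  {for x, continuous f} -> {for x, continuous g} ->
  {for x, continuous (fun y => dot (f y) (g y))}.
Proof.
move=> cf cg; pose fg y := (f y, g y).
have cfg : {for x, continuous fg} by exact: (cvg_pair cf cg).
pose h (z : 'rV[R]_n * 'rV[R]_n) := dot z.1 z.2.
have ch : {for fg x, continuous h} by exact: dot_continuous.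
exact: (continuous_comp cfg ch).
Qed.

Lemma dotl_continuous p : continuous (fun x => dot x p).
Proof.
move=> x; have cx : {for x, continuous (@id 'rV[R]_n)} by [].
exact: (dot_cvg cx (@cst_continuous _ _ p x)).
Qed.

Lemma dotr_continuous x : continuous (fun p => dot x p).
Proof.
move=> p; have cp : {for p, continuous (@id 'rV[R]_n)} by [].
exact: (dot_cvg (@cst_continuous _ _ x p) cp).
Qed.

Lemma derive_grad (f : 'rV[R]_n -> R) x v : differentiable f x ->
  'D_v f x = dot v (grad f x).
Proof.
by move=> df; rewrite derive_coordE//; apply: eq_bigr => i _; rewrite mxE.
Qed.

End Dot.

Section ConvexSets.
Context {R : realType} {n : nat}.
Implicit Types (X : set 'rV[R]_n) (x y z p : 'rV[R]_n).

Lemma convex_segment X x y (t : R) : convex_set X -> X x -> X y ->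
  0 <= t <= 1 -> X (x + t *: (y - x)).
Proof.
move=> cX Xx Xy /andP[t0 t1].
have := cX y x (Itv01 t0 t1); rewrite !inE => /(_ Xy Xx).
rewrite /conv /=; congr (X _).
by apply/rowP => i; rewrite !mxE /unstable.onem; ring.
Qed.

(** The homothety of centre [y] and ratio [1 - t] maps [X] into itself and carries a ball around [x]
    to a ball around the given point; [w] below is the preimage of [z]. *)
Lemma interior_segment X x y (t : R) : convex_set X -> X° x -> X y ->
  0 <= t < 1 -> X° (x + t *: (y - x)).
Proof.
move=> cX Xx Xy /andP[t0 t1]; have t1' : 0 < 1 - t by rewrite subr_gt0.
move: Xx => /nbhs_ballP[r /= r0 rX].
apply/nbhs_ballP; exists (r * (1 - t)); first by rewrite /= mulr_gt0.
move=> z; rewrite -ball_normE /= => zr.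
pose w := (1 - t)^-1 *: (z - t *: y).
have Xw : X w.
  apply: rX; rewrite -ball_normE /=.
  have -> : x - w = (1 - t)^-1 *: (x + t *: (y - x) - z).
    apply: (@scalerI _ _ (1 - t)); first by rewrite gt_eqF.
    rewrite scalerA divff ?gt_eqF// scale1r scalerBr scalerA divff ?gt_eqF//.
    rewrite scale1r scalerBl scale1r scalerBr opprB.
    by apply/rowP => i; rewrite !mxE; ring.
  by rewrite normrZ gtr0_norm ?invr_gt0// mulrC ltr_pdivrMr.
have -> : z = w + t *: (y - w).
  rewrite scalerBr addrCA -[X in X + (_ - _)]scale1r.
  apply/rowP => i; rewrite !mxE; field.
  by rewrite gt_eqF.
by apply: convex_segment => //; rewrite t0 ltW.
Qed.

(** Distances are measured with [dot], not with the sup norm: the obtuse angle property of the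
    projection is Euclidean. *)
Lemma nearest_point X z : closed X -> bounded_set X -> convex_set X ->
  X !=set0 -> exists2 y, X y & forall x, X x -> dot (x - y) (z - y) <= 0.
Proof.
move=> clX bX cX X0.
have [||y yX ymin] := @EVT_min_rV R n (fun y => dot (z - y) (z - y)) X X0.
- exact: bounded_closed_compact.
- apply: continuous_subspaceT => y.
  have cz : {for y, continuous (fun y => z - y)}.
    by apply: continuousB; [exact: cst_continuous|].
  exact: (dot_cvg cz cz).
rewrite inE in yX; exists y => // x Xx.
apply/ler_addgt0Pr => e e0; rewrite add0r.
set w := x - y; set c := z - y; set a := dot w c; pose b := dot w w.
have b0 : 0 <= b by exact: dotxx_ge0.
(* Minimality of [y] against [y + t w] gives [2 a <= t b]; this [t] makes the right-hand side at
   most [e]. *)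
pose t := Num.min 1 (e / (b + 1)).
have t0 : 0 < t by rewrite lt_min ltr01 divr_gt0// ltr_pwDr.
have t1 : t <= 1 by rewrite ge_min lexx.
have tb : t * b <= e.
  apply: (@le_trans _ _ (t * (b + 1))); first by rewrite ler_pM2l// lerDl.
  by rewrite -ler_pdivlMr ?ltr_pwDr// ge_min lexx orbT.
have Xt : X (y + t *: w) by apply: convex_segment => //; rewrite ltW.
have : dot c c <= dot (c - t *: w) (c - t *: w).
  have -> : c - t *: w = z - (y + t *: w) by rewrite opprD addrA.
  by apply: ymin; rewrite inE.
rewrite dot_subZ -/a -/b => H.
have {}H : t * (2 * a) <= t * (t * b) by lra.
rewrite ler_pM2l// in H; lra.
Qed.

Lemma bounded_setP X : bounded_set X -> exists2 M : R, 0 < M & forall x, X x -> `|x| <= M.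
Proof.
move=> bX; have /ex_strict_bound_gt0[M M0 HM] : bounded_set X by [].
by exists M => // x Xx; rewrite ltW// HM.
Qed.

(* Projecting a point [z] outside [X] onto [X] yields an element of the polar
   that is unbounded in scale or has norm at least [1 / (n |z|)]. *)
Lemma interior0_polar_bounded X : closed X -> bounded_set X -> convex_set X ->
  X !=set0 -> bounded_set (polar X) -> X° 0.
Proof.
move=> clX bX cX X0 /bounded_setP[M M0 HM].
have d0 : 0 < (n%:R * M + 1)^-1 by rewrite invr_gt0 ltr_pwDr// mulr_ge0// ltW.
apply/nbhs_ballP; exists (n%:R * M + 1)^-1 => // z.
rewrite -ball_normE /= sub0r normrN => zd; apply: contrapT => nXz.
have [y Xy Hy] := nearest_point z clX bX cX X0.
set e := z - y in Hy.
have e0 : e != 0.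
  by apply/eqP => /subr0_eq zy; apply: nXz; rewrite zy.
have He x : X x -> dot x e <= dot y e.
  by move=> /Hy; rewrite dotBl subr_le0.
have ze : dot y e < dot z e.
  by rewrite -subr_gt0 -dotBl dotxx_gt0.
have e00 : 0 < `|e| by rewrite normr_gt0.
have [ye|ye] := leP (dot y e) 0.
  have : polar X (((M + 1) / `|e|) *: e).
    move=> x Xx; rewrite dotZr (@le_trans _ _ 0)// mulr_ge0_le0//.
      by rewrite divr_ge0// ltW// ltr_pwDr// ltW.
    exact: le_trans (He x Xx) ye.
  move=> /HM; rewrite normrZ ger0_norm; last first.
    by rewrite divr_ge0// ltW// ltr_pwDr// ltW.
  by rewrite divfK ?gt_eqF// gerDl ler10.
have : polar X ((dot y e)^-1 *: e).
  by move=> x Xx; rewrite dotZr mulrC ler_pdivrMr// mul1r He.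
move=> /HM; set q := _ *: e => qM.
have zq : 1 < dot z q by rewrite dotZr mulrC ltr_pdivlMr// mul1r.
have : 1 < n%:R * `|z| * `|q|.
  by rewrite (lt_le_trans zq)// (le_trans (ler_norm _))// dot_norm_le.
apply/negP; rewrite -leNgt.
apply: (@le_trans _ _ (`|z| * (n%:R * M))).
  by rewrite (mulrC n%:R `|z|) -mulrA ler_wpM2l// ler_wpM2l.
apply: (@le_trans _ _ (`|z| * (n%:R * M + 1))); first by rewrite ler_wpM2l// lerDl.
by rewrite -ler_pdivlMr ?div1r 1?ltW// ltr_pwDr// mulr_ge0// ltW.
Qed.

Definition npolar X : set 'rV[R]_n := -%R @` polar X.

Lemma npolarE X : npolar X = [set p | forall x, X x -> 0 <= 1 + dot x p].
Proof.
apply/seteqP; split=> [_ [q Xq <-] x Xx|p Hp] /=.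
  by rewrite dotNr subr_ge0; exact: Xq.
exists (- p); last by rewrite opprK.
by move=> x /Hp; rewrite dotNr -(subr_ge0 (- _)) opprK.
Qed.

(** If [p] is interior, [(1 + t) p] is still in the set for some [t > 0], so
    [(1 + t) (1 + <x, p>) >= t]. Conversely, compactness of [X] lets the strict inequalities at [p]
    persist for all nearby [q], uniformly in [x]. *)
Lemma interior_npolarE X : closed X -> bounded_set X ->
  (npolar X)° = [set p | forall x, X x -> 0 < 1 + dot x p].
Proof.
move=> clX bX; rewrite npolarE; apply/seteqP; split=> p.
  move=> /nbhs_ballP[r /= r0 rH] x Xx.
  have p10 : 0 < `|p| + 1 by rewrite ltr_pwDr.
  pose t := r / (2 * (`|p| + 1)).
  have t0 : 0 < t by rewrite divr_gt0// mulr_gt0.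
  have : ball p r (p + t *: p).
    rewrite -ball_normE /= opprD addNKr normrN normrZ gtr0_norm// /t.
    rewrite mulrAC ltr_pdivrMr ?mulr_gt0// ltr_pM2l//.
    by have := normr_ge0 p; lra.
  move=> /rH /(_ x Xx); rewrite dotDr dotZr => H.
  suff : 0 < (1 + t) * (1 + dot x p) by rewrite pmulr_rgt0// ltr_pwDr.
  lra.
move=> Hp; have cX := bounded_closed_compact bX clX.
have : \forall q \near p, X `<=` (fun x => 0 < 1 + dot x q).
  have ncX : near_covering X by apply/compact_near_coveringP.
  apply: (ncX _ (nbhs p) (fun q x => 0 < 1 + dot x q) (nbhs_filter p)) => x Xx.
  have c : {for (x, p), continuous (fun z : 'rV[R]_n * 'rV[R]_n => 1 + dot z.1 z.2)}.
    exact: (continuousD (@cst_continuous _ _ _ _) (@dot_continuous _ _ _)).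
  exact: (cvgr_gt (1 + dot x p) c 0 (Hp x Xx)).
apply: filterS => q Hq x Xx; rewrite ltW//; exact: Hq.
Qed.

Lemma regular_convex_npolar X : closed X -> bounded_set X ->
  bounded_set (polar X) -> regular_convex (npolar X).
Proof.
move=> clX bX bpX; split.
- rewrite npolarE.
  have -> : [set p | forall x, X x -> 0 <= 1 + dot x p] =
      \bigcap_(x in X) ((fun p => 1 + dot x p) @^-1` [set y | 0 <= y]).
    by [].
  apply: closed_bigI => x Xx; apply: preimage_closed; last exact: closed_ge.
  move=> p _.
  exact: (continuousD (@cst_continuous _ _ _ _) (@dotr_continuous _ _ _ _)).
- rewrite npolarE => p q t; rewrite !inE => Hp Hq x Xx.
  have := Hp x Xx; have := Hq x Xx.
  rewrite /conv /= dotDr !dotZr /unstable.onem => H1 H2.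
  have : 0 <= t%:num * (1 + dot x p) + (1 - t%:num) * (1 + dot x q).
    by rewrite addr_ge0// mulr_ge0// subr_ge0.
  rewrite (_ : _ + _ = 1 + (t%:num * dot x p + (1 - t%:num) * dot x q))//.
  by ring.
- exists 0; rewrite interior_npolarE// => x _ /=.
  by rewrite dot0r addr0.
- move=> [p [v [v0 H]]].
  have [M M0 HM] := bounded_setP bpX.
  have Hn q : npolar X q -> `|q| <= M by move=> [r /HM + <-]; rewrite normrN.
  have v00 : 0 < `|v| by rewrite normr_gt0.
  pose t := (M + M + 1) / `|v|.
  have H1 := Hn _ (H t).
  have H2 := Hn _ (H 0).
  rewrite scale0r addr0 in H2.
  have : `|t *: v| <= M + M.
    have -> : t *: v = (p + t *: v) - p by rewrite addrC addKr.
    by rewrite (le_trans (ler_normB _ _))// lerD.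
  rewrite normrZ gtr0_norm ?divr_gt0 ?addr_gt0// divfK ?gt_eqF//.
  by rewrite gerDl ler10.
Qed.

End ConvexSets.

(** * Concavity and the slope at the boundary *)

Section RealDerivatives.
Context {R : realType}.

Lemma is_derive_comp1 (f g : R -> R) (x df dg : R) :
  is_derive x 1 f df -> is_derive (f x) 1 g dg ->
  is_derive x 1 (fun y => g (f y)) (dg * df).
Proof.
move=> Hf Hg; have f1 : differentiable f x.
  by apply/derivable1_diffP; exact: ex_derive.
split.
  by apply/derivable1_diffP; exact: (differentiable_comp1 f1 Hg).
by rewrite (derive_comp1 _ f1 Hg) (@derive_val _ _ _ _ _ _ _ Hf).
Qed.

Lemma derive_le0_le (k dk : R -> R) (t : R) : 0 <= t ->
  (forall s, 0 <= s <= t -> is_derive s 1 k (dk s)) ->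
  (forall s, 0 <= s <= t -> dk s <= 0) -> k t <= k 0.
Proof.
rewrite le_eqVlt => /orP[/eqP <- //|t0] H1 H2.
have [s /andP[s0 st] E] := MVT0 t0 H1.
by rewrite -subr_le0 E mulr_le0_ge0 ?(ltW t0)// H2// !ltW.
Qed.

(* The differential inequality reads [|(ln (s f0^4))'| <= 2 gamma sqrt s] with
   [s = - f2 / f0]. Hence [k = 1 / (sqrt s f0^2)] satisfies
   [k' <= gamma / f0^2], so that [k] grows at most like [1 / (1 - t)]. Together
   with [f0 <= M (1 - t)] this makes [- f2] at least of order [1 / (1 - t)],
   and [f1] tends to [- oo]. *)
Lemma no_linear_bound (gamma M : R) (f0 f1 f2 f3 : R -> R) :
  0 <= gamma -> 0 < M ->
  (forall t : R, 0 <= t < 1 -> is_derive t 1 f0 (f1 t)) ->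
  (forall t : R, 0 <= t < 1 -> is_derive t 1 f1 (f2 t)) ->
  (forall t : R, 0 <= t < 1 -> is_derive t 1 f2 (f3 t)) ->
  (forall t : R, 0 <= t < 1 -> 0 < f0 t) ->
  (forall t : R, 0 <= t < 1 -> 0 < - f2 t) ->
  (forall t : R, 0 <= t < 1 -> f0 t <= M * (1 - t)) ->
  (forall t : R, 0 <= t < 1 -> - M <= f1 t) ->
  (forall t : R, 0 <= t < 1 -> (1 - t) * f0 0 <= f0 t) ->
  (forall t : R, 0 <= t < 1 -> `|f3 t / f0 t + 3 * f2 t * f1 t / f0 t ^+ 2|
     <= 2 * gamma * (- f2 t / f0 t) `^ (3 / 2)) -> False.
Proof.
move=> g0 M0 d0 d1 d2 f0_gt0 f2_lt0 f0_le f1_ge f0_ge psc.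
have z01 : 0 <= (0 : R) < 1 by rewrite lexx ltr01.
have f00 := f0_gt0 0 z01.
have lt1 (s t : R) : 0 <= t < 1 -> 0 <= s <= t -> 0 <= s < 1.
  by move=> /andP[_ t1] /andP[-> st] /=; exact: le_lt_trans st t1.
pose k t := expR (- 2^-1 * (ln (- f2 t) + 3 * ln (f0 t))).
(* The logarithmic derivative of [- f2 * f0 ^ 3], whose power of exponent [-1/2] is [k]; hence
   [k' = - k E / 2]. *)
pose E t := f3 t / f2 t + 3 * f1 t / f0 t.
have dk (t : R) : 0 <= t < 1 -> is_derive t 1 k (k t * (- 2^-1 * E t)).
  move=> t01.
  have da : is_derive t 1 (fun s => ln (- f2 s)) ((- f2 t)^-1 * - f3 t) :=
    is_derive_comp1 (is_deriveN (d2 t t01)) (is_derive1_ln (f2_lt0 t t01)).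
  have db : is_derive t 1 (fun s => ln (f0 s)) ((f0 t)^-1 * f1 t) :=
    is_derive_comp1 (d0 t t01) (is_derive1_ln (f0_gt0 t t01)).
  have dq : is_derive t 1 (fun s => - 2^-1 * (ln (- f2 s) + 3 * ln (f0 s)))
      (- 2^-1 * ((- f2 t)^-1 * - f3 t + 3 * ((f0 t)^-1 * f1 t))) :=
    is_deriveZ (- 2^-1) (is_deriveD da (is_deriveZ 3 db)).
  apply: is_derive_eq (is_derive_comp1 dq (is_derive_expR _)) _.
  by rewrite /E invrN mulrNN -!mulrA ![_^-1 * _]mulrC.
have dk_le (t : R) : 0 <= t < 1 -> k t * (- 2^-1 * E t) <= gamma / f0 t ^+ 2.
  move=> t01; have p0 := f0_gt0 t t01; have p2 := f2_lt0 t t01.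
  have k0 : 0 < k t by exact: expR_gt0.
  set s := - f2 t / f0 t; have s0 : 0 < s by rewrite divr_gt0.
  (* The square root of [s]. Condition (3) becomes [|E| <= 2 gamma r], and [k r] is exactly
     [1 / f0 ^ 2]. *)
  pose r := expR (2^-1 * ln s).
  have r0 : 0 < r by exact: expR_gt0.
  have sr : s `^ (3 / 2) = s * r.
    rewrite /powR gt_eqF// -[X in X * r](lnK s0) -expRD; congr expR.
    by field.
  have Er : `|E t| <= 2 * gamma * r.
    rewrite -(ler_pM2l s0); have := psc t t01; rewrite -/s sr.
    rewrite (_ : f3 t / f0 t + _ = - s * E t); last first.
      by rewrite /s /E; field; rewrite gt_eqF// lt_eqF// -oppr_gt0.
    rewrite normrM normrN (gtr0_norm s0) => H.
    by rewrite (le_trans H)// le_eqVlt; apply/orP; left; apply/eqP; ring.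
  have kr : k t * r = (f0 t ^+ 2)^-1.
    rewrite /k /r -expRD /s lnM ?posrE ?invr_gt0// lnV ?posrE//.
    rewrite -[RHS]lnK ?posrE ?invr_gt0 ?exprn_gt0//; congr expR.
    by rewrite lnV ?posrE ?exprn_gt0// lnXn// -mulr_natl; field.
  apply: (@le_trans _ _ (k t * (gamma * r))).
    rewrite ler_pM2l//; have := ler_norm (- E t); rewrite normrN => H.
    rewrite -mulrA in Er.
    by move: H Er; move: (E t) `|E t| (gamma * r) => e1 e2 e3; lra.
  by rewrite mulrCA kr.
have dl (t : R) : 0 <= t < 1 -> is_derive t 1 (fun s : R => ln (1 - s)) (- (1 - t)^-1).
  move=> /andP[_ t1]; have t1' : 0 < 1 - t by rewrite subr_gt0.
  have d : is_derive t 1 (fun s : R => 1 - s) (0 - 1) :=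
    is_deriveB (is_derive_cst (1 : R) t 1) (is_derive_id t 1).
  apply: is_derive_eq (is_derive_comp1 d (is_derive1_ln t1')) _.
  by rewrite sub0r mulrN1.
pose c0 := gamma / f0 0 ^+ 2.
have c00 : 0 <= c0 by rewrite divr_ge0// exprn_ge0// ltW.
pose A := k 0 + c0.
have A0 : 0 < A by rewrite ltr_pwDl// expR_gt0.
have k_le (t : R) : 0 <= t < 1 -> k t <= A / (1 - t).
  move=> t01; have /andP[t0 t1] := t01.
  have t1' : 0 < 1 - t by rewrite subr_gt0.
  (* From [f0 s >= (1 - s) f0 0] one gets [k' <= c0 / (1 - s) ^ 2]; subtracting the antiderivative
     [c0 / (1 - s)], written with [expR] and [ln], leaves a nonincreasing function. *)
  pose kk s := k s - c0 * expR (- ln (1 - s)).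
  have dkk (s : R) : 0 <= s <= t -> is_derive s 1 kk
      (k s * (- 2^-1 * E s) - c0 * (expR (- ln (1 - s)) * - - (1 - s)^-1)).
    move=> st; have s01 := lt1 _ _ t01 st.
    exact: (is_deriveB (dk s s01) (is_deriveZ c0
      (is_derive_comp1 (is_deriveN (dl s s01)) (is_derive_expR _)))).
  have := derive_le0_le t0 dkk; rewrite /kk subr0 ln1 oppr0 expR0 mulr1.
  rewrite expRN lnK ?posrE// => H.
  have : k t - c0 / (1 - t) <= k 0 - c0.
    apply: H => s st; have s01 := lt1 _ _ t01 st.
    have s1 : 0 < 1 - s by rewrite subr_gt0; case/andP: s01.
    rewrite subr_le0 (le_trans (dk_le s s01))//.
    rewrite expRN lnK ?posrE// opprK -invfM -expr2 /c0 -mulrA ler_wpM2l//.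
    rewrite -invfM -exprMn lef_pV2 ?posrE ?exprn_gt0 ?mulr_gt0 ?f0_gt0//.
    by rewrite lerXn2r ?nnegrE ?mulr_ge0 ?(ltW f00) ?(ltW s1) ?(ltW (f0_gt0 s s01))//
      mulrC f0_ge.
  have i1 : 1 <= (1 - t)^-1 by rewrite invf_ge1// gerBl.
  have k0 : k 0 <= k 0 / (1 - t) by rewrite ler_peMr// expR_ge0.
  rewrite /A mulrDl; move: k0; move: (k 0 / _) (c0 / _) => e1 e2; lra.
(* Since [- f2 k ^ 2 f0 ^ 3 = 1], the bounds [k <= A / (1 - t)] and [f0 <= M (1 - t)] give
   [1 <= - f2 A ^ 2 M ^ 3 (1 - t)]. *)
pose c := (A ^+ 2 * M ^+ 3)^-1.
have c_gt0 : 0 < c by rewrite invr_gt0 mulr_gt0// exprn_gt0.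
have f2_le (t : R) : 0 <= t < 1 -> f2 t + c / (1 - t) <= 0.
  move=> t01; have /andP[t0 t1] := t01.
  have t1' : 0 < 1 - t by rewrite subr_gt0.
  have p0 := f0_gt0 t t01; have p2 := f2_lt0 t t01.
  have kE : - f2 t * (k t ^+ 2 * f0 t ^+ 3) = 1.
    rewrite /k; set a := ln (- f2 t); set b := ln (f0 t).
    rewrite -[X in X * _](lnK p2) -[X in _ * (_ * X ^+ _)](lnK p0) -/a -/b.
    rewrite -!expRM_natl -!expRD.
    by rewrite -[RHS]expR0; congr expR; field.
  have H : k t ^+ 2 * f0 t ^+ 3 <= (A / (1 - t)) ^+ 2 * (M * (1 - t)) ^+ 3.
    apply: ler_pM; rewrite ?exprn_ge0 ?expR_ge0 ?(ltW p0)//.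
      by rewrite lerXn2r ?nnegrE ?expR_ge0 ?divr_ge0 ?k_le ?(ltW A0) ?(ltW t1').
    by rewrite lerXn2r ?nnegrE ?(ltW p0) ?mulr_ge0 ?f0_le ?(ltW M0) ?(ltW t1').
  rewrite addrC -[f2 t]opprK subr_le0 /c -invfM -[leLHS]mul1r ler_pdivrMr; last first.
    by rewrite mulr_gt0// mulr_gt0// exprn_gt0.
  rewrite -[leLHS]kE ler_pM2l// (le_trans H)// le_eqVlt; apply/orP; left; apply/eqP.
  by field; rewrite gt_eqF.
(* Integrating [f2 <= - c / (1 - t)] gives [f1 t <= f1 0 + c ln (1 - t)]. At [1 - t = exp (- L)] the
   right-hand side is [f1 0 - |f1 0| - M - 1], below the allowed [- M]. *)
pose L := (`|f1 0| + M + 1) / c.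
have L0 : 0 < L by rewrite divr_gt0// ltr_pwDr// addr_ge0// ltW.
pose t := 1 - expR (- L).
have t01 : 0 <= t < 1.
  rewrite /t subr_ge0 gtrBl expR_gt0 andbT -[leRHS]expR0 ler_expR.
  by rewrite oppr_le0 ltW.
have t0 : 0 <= t by case/andP: t01.
pose m s := f1 s - c * ln (1 - s).
have dm (s : R) : 0 <= s <= t -> is_derive s 1 m (f2 s - c * - (1 - s)^-1).
  move=> st; have s01 := lt1 _ _ t01 st.
  exact: (is_deriveB (d1 s s01) (is_deriveZ c (dl s s01))).
have : m t <= m 0.
  apply: (derive_le0_le t0 dm) => s st.
  by rewrite mulrN opprK; apply: f2_le; exact: lt1 st.
have cL : c * L = `|f1 0| + M + 1 by rewrite /L mulrC divfK ?gt_eqF.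
rewrite /m subr0 ln1 mulr0 subr0 {2}/t subKr expRK mulrN opprK cL -/t.
have := f1_ge t t01; have := ler_norm (f1 0); move: `|f1 0| => e; lra.
Qed.

End RealDerivatives.

(** * Tangent inequalities for a strictly concave function *)

Section Concave.
Context {R : realType} {n : nat}.
Variables (X : set 'rV[R]_n) (u : 'rV[R]_n -> R).
Hypothesis cX : convex_set X.
Hypothesis Cu : C_on 3 X° u.
Hypothesis u_gt0 : forall x, X° x -> 0 < u x.
Hypothesis D2u_lt0 : forall x h, X° x -> h != 0 -> D2 u x h < 0.
Implicit Types (x y v : 'rV[R]_n).

Let oX : open X° := @open_interior _ X.

Lemma line_derive x v (t : R) : X° (x + t *: v) ->
  is_derive t 1 (fun s => u (x + s *: v)) ('D_v u (x + t *: v)).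
Proof.
move=> H; apply: is_derive_line; apply: diff_derivable.
exact: C_on_diff Cu H.
Qed.

Lemma line_derive2 x v (t : R) : X° (x + t *: v) ->
  is_derive t 1 (fun s => 'D_v u (x + s *: v)) (D2 u (x + t *: v) v).
Proof.
move=> H; apply: is_derive_line; apply: diff_derivable.
exact: C_on_diff (C_on_derive v Cu) H.
Qed.

Lemma line_derive3 x v (t : R) : X° (x + t *: v) ->
  is_derive t 1 (fun s => D2 u (x + s *: v) v) (D3 u (x + t *: v) v).
Proof.
move=> H; apply: (@is_derive_line _ _ _ ('D_v ('D_v u))); apply: diff_derivable.
exact: C_on_diff (C_on_derive v (C_on_derive v Cu)) H.
Qed.

Lemma tangent_gt x y : X° x -> X° y -> y != x -> u y < u x + 'D_(y - x) u x.
Proof.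
move=> Xx Xy yx; set v := y - x.
have v0 : v != 0 by rewrite subr_eq0.
have XX : X y by exact: interior_subset.
have xv : x + v = y by rewrite addrC subrK.
have Xs s : 0 <= s <= 1 -> X° (x + s *: v).
  move=> /andP[s0]; rewrite le_eqVlt => /orP[/eqP ->|s1].
    by rewrite scale1r xv.
  by apply: interior_segment => //; rewrite s0.
have [s /andP[s0 s1] E1] := MVT0 ltr01 (fun s st => line_derive (Xs s st)).
have [q /andP[q0 q1] E2] := MVT0 s0 (fun q (qt : 0 <= q <= s) =>
  line_derive2 (Xs q (andb_true_intro (conj (proj1 (andP qt))
    (le_trans (proj2 (andP qt)) (ltW s1)))))).
rewrite /= scale1r scale0r addr0 xv mulr1 in E1.
rewrite /= scale0r addr0 in E2.
have Xq : X° (x + q *: v) by apply: Xs; rewrite !ltW// (lt_trans q1).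
have : D2 u (x + q *: v) v * s < 0 by rewrite pmulr_llt0// D2u_lt0.
rewrite -E2 -E1; move: ('D_v u x) (u x) (u y) => a b c.
by rewrite subr_lt0 ltrBlDl.
Qed.

(** Here [y] may lie on the boundary, where nothing is known of [u]; positivity at the interior
    points of the segment bounds the tangent there, and the bound is carried to the end. *)
Lemma tangent_ge0 x y : X° x -> X y -> 0 <= u x + 'D_(y - x) u x.
Proof.
move=> Xx Xy; set v := y - x.
have H s : 0 < s < 1 -> 0 <= u x + s * 'D_v u x.
  move=> /andP[s0 s1]; have Xz : X° (x + s *: v).
    by apply: interior_segment => //; rewrite ltW.
  have [v0|v0] := eqVneq v 0.
    by rewrite v0 derive0 mulr0 addr0 ltW// u_gt0.
  have zx : x + s *: v - x = s *: v by rewrite addrAC subrr add0r.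
  have := tangent_gt Xx Xz; rewrite -subr_eq0 zx scaler_eq0 negb_or v0 gt_eqF//.
  have dux : differentiable u x by exact: C_on_diff Cu Xx.
  move=> /(_ isT) K; rewrite ltW// (lt_trans (u_gt0 Xz))//.
  by move: K; rewrite !deriveE// linearZ.
move: (u x) ('D_v u x) H => a b H; rewrite leNgt; apply/negP => ab.
have a0 : 0 <= a.
  have := H 2^-1; rewrite invr_gt0 ltr0n invf_lt1// ltr1n => /(_ isT) K.
  lra.
have b0 : b < 0 by lra.
have bb : b != 0 by rewrite lt_eqF.
(* The midpoint between the root [- a / b] of [a + s b] and 1, where this affine function takes the
   negative value [(a + b) / 2]. *)
pose s := (1 - a / b) / 2.
have sb : s * b = (b - a) / 2 by rewrite /s; field.
have ab1 : - (a / b) < 1 by rewrite -mulNr ltr_ndivrMr// mul1r; lra.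
have ab0 : 0 <= - (a / b) by rewrite -mulrN mulr_ge0// -invrN invr_ge0; lra.
have := H s; rewrite sb => K.
have : 0 <= a + (b - a) / 2 by apply: K; apply/andP; split; rewrite /s; lra.
lra.
Qed.

(** Both inequalities come from the tangent at the point [z] of the segment: it is nonnegative at
    [y] and at least [u x] at [x]. Weighted by [t] and [1 - t], their slope terms cancel. *)
Lemma ray_ge x y (t : R) : X° x -> X y -> 0 <= t < 1 ->
  (1 - t) * u x <= u (x + t *: (y - x)).
Proof.
move=> Xx Xy t01; have /andP[t0 t1] := t01.
have Xz : X° (x + t *: (y - x)) by exact: interior_segment.
set z := _ + _ in Xz *.
have duz : differentiable u z by exact: C_on_diff Cu Xz.
have zy : y - z = (1 - t) *: (y - x).
  by apply/rowP => i; rewrite !mxE; ring.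
have zx : x - z = (- t) *: (y - x).
  by apply/rowP => i; rewrite !mxE; ring.
have := tangent_ge0 Xz Xy; rewrite zy.
have K : u x <= u z + 'D_(x - z) u z.
  have [->|xz] := eqVneq x z; first by rewrite subrr derive0 addr0.
  by rewrite ltW// tangent_gt.
move: K; rewrite zx !deriveE// !linearZ /=.
move: (u x) (u z) ('d u z (y - x)) => a b c K1 K2.
rewrite /GRing.scale /= in K1 K2.
have : 0 <= t * (b + (1 - t) * c) + (1 - t) * (b + (- t) * c - a).
  by rewrite addr_ge0// mulr_ge0//; lra.
have -> : t * (b + (1 - t) * c) + (1 - t) * (b + (- t) * c - a) = b - (1 - t) * a.
  ring.
by rewrite subr_ge0.
Qed.

(** Strictness comes from the midpoint: [u x / 2 <= u z < u x + 'D_(y - x) u x / 2]. *)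
Lemma tangent_gt0 x y : X° x -> X y -> 0 < u x + 'D_(y - x) u x.
Proof.
move=> Xx Xy; have [->|yx] := eqVneq y x.
  by rewrite subrr derive0 addr0 u_gt0.
have t01 : 0 <= (2^-1 : R) < 1 by rewrite invr_ge0 ler0n invf_lt1// ltr1n.
have := ray_ge Xx Xy t01.
have Xz : X° (x + 2^-1 *: (y - x)) by exact: interior_segment.
have zx : x + 2^-1 *: (y - x) - x = 2^-1 *: (y - x).
  by rewrite addrAC subrr add0r.
have := tangent_gt Xx Xz; rewrite -subr_eq0 zx scaler_eq0.
rewrite subr_eq0 (negbTE yx) orbF invr_eq0 pnatr_eq0 => /(_ isT).
have dux : differentiable u x by exact: C_on_diff Cu Xx.
rewrite !deriveE// linearZ /= /GRing.scale /=.
move: (u (_ + _)) (u x) ('d u x (y - x)) => a b c; lra.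
Qed.

(** Otherwise [u <= M (1 - t)] along the segment. As the tangent at each of its points is
    nonnegative at [y], the slope is at least [- M], and the restriction of [u] satisfies every
    condition of [no_linear_bound]. *)
Lemma slope_unbounded (gamma M : R) x y : 0 <= gamma -> 0 < M ->
  (forall x h, X° x -> `|D3 u x h / u x + 3 * D2 u x h * D1 u x h / u x ^+ 2|
     <= 2 * gamma * (- D2 u x h / u x) `^ (3 / 2)) ->
  X° x -> X y -> y != x ->
  exists2 t : R, 0 <= t < 1 & M * (1 - t) < u (x + t *: (y - x)).
Proof.
move=> g0 M0 psc Xx Xy yx; apply: contrapT => noM.
set v := y - x in noM *; have v0 : v != 0 by rewrite subr_eq0.
pose z t : 'rV[R]_n := x + t *: v.
have Xz (t : R) : 0 <= t < 1 -> X° (z t) by exact: interior_segment.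
have uM (t : R) : 0 <= t < 1 -> u (z t) <= M * (1 - t).
  by move=> t01; rewrite leNgt; apply/negP => H; apply: noM; exists t.
pose f0 t := u (z t); pose f1 t := 'D_v u (z t).
pose f2 t := D2 u (z t) v; pose f3 t := D3 u (z t) v.
have d0 (t : R) : 0 <= t < 1 -> is_derive t 1 f0 (f1 t).
  by move=> t01; apply: line_derive; exact: Xz.
have d1 (t : R) : 0 <= t < 1 -> is_derive t 1 f1 (f2 t).
  by move=> t01; apply: line_derive2; exact: Xz.
have d2 (t : R) : 0 <= t < 1 -> is_derive t 1 f2 (f3 t).
  by move=> t01; apply: line_derive3; exact: Xz.
have f0_gt0 (t : R) : 0 <= t < 1 -> 0 < f0 t by move=> t01; apply: u_gt0; exact: Xz.
have f2_lt0 (t : R) : 0 <= t < 1 -> 0 < - f2 t.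
  by move=> t01; rewrite oppr_gt0; apply: D2u_lt0 => //; exact: Xz.
have f1_ge (t : R) : 0 <= t < 1 -> - M <= f1 t.
  move=> t01; have Xzt := Xz t t01; have := tangent_ge0 Xzt Xy.
  have -> : y - z t = (1 - t) *: v by apply/rowP => i; rewrite !mxE; ring.
  have du : differentiable u (z t) by exact: C_on_diff Cu Xzt.
  rewrite deriveE// linearZ /= -deriveE// /GRing.scale /= => K.
  have := uM t t01; move: K; rewrite -/(f1 t) => K1 K2.
  have t1 : 0 < 1 - t by rewrite subr_gt0; case/andP: t01.
  rewrite -(ler_pM2l t1); lra.
have f0_ge (t : R) : 0 <= t < 1 -> (1 - t) * f0 0 <= f0 t.
  by move=> t01; have := ray_ge Xx Xy t01; rewrite /f0 /z scale0r addr0.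
have psct (t : R) : 0 <= t < 1 ->
    `|f3 t / f0 t + 3 * f2 t * f1 t / f0 t ^+ 2| <=
      2 * gamma * (- f2 t / f0 t) `^ (3 / 2).
  by move=> t01; apply: psc; exact: Xz.
exact: (no_linear_bound g0 M0 d0 d1 d2 f0_gt0 f2_lt0 uM f1_ge f0_ge psct).
Qed.

End Concave.

(** * The dual map *)

Section ProductRules.
Context {R : realType} {V : normedModType R}.
Implicit Types (a b c : V -> R) (x h : V).

Lemma is_derive_mul a b x h da db : is_derive x h a da -> is_derive x h b db ->
  is_derive x h (fun y => a y * b y) (a x * db + b x * da).
Proof. by move=> Ha Hb; exact: is_deriveM. Qed.

Lemma is_derive_opp a x h da : is_derive x h a da ->
  is_derive x h (fun y => - a y) (- da).
Proof. by move=> Ha; exact: is_deriveN. Qed.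

Lemma is_derive_sub a b x h da db : is_derive x h a da -> is_derive x h b db ->
  is_derive x h (fun y => a y - b y) (da - db).
Proof. by move=> Ha Hb; exact: is_deriveB. Qed.

End ProductRules.

(** * The barrier conditions in terms of [exp (- f)] *)

Section ExpTransform.
Context {R : realType} {n : nat}.
Variables (U : set 'rV[R]_n) (f : 'rV[R]_n -> R).
Hypotheses (oU : open U) (Cf : C_on 3 U f).
Let u x := expR (- f x).
Implicit Types (x h : 'rV[R]_n).

Let diff_f x : U x -> differentiable f x.
Proof. exact: C_on_diff Cf. Qed.

Let diff_f1 h x : U x -> differentiable ('D_h f) x.
Proof. exact: C_on_diff (C_on_derive h Cf). Qed.

Let diff_f2 h x : U x -> differentiable ('D_h ('D_h f)) x.
Proof. exact: C_on_diff (C_on_derive h (C_on_derive h Cf)). Qed.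

Let diff_u x : U x -> differentiable u x.
Proof.
move=> Ux; apply: (differentiable_comp1 (f := fun x => - f x) _ (is_derive_expR _)).
by apply: differentiableN; exact: diff_f.
Qed.

Lemma D1_expN x h : U x -> D1 u x h = - (u x * D1 f x h).
Proof.
move=> Ux; have df := diff_f Ux.
rewrite /D1 (derive_comp1 (f := fun x => - f x) h (differentiableN df) (is_derive_expR _)).
by rewrite deriveN ?mulrN//; exact: diff_derivable.
Qed.

Lemma D2_expN x h : U x -> D2 u x h = u x * (D1 f x h ^+ 2 - D2 f x h).
Proof.
move=> Ux.
have E : \forall y \near x, - (u y * 'D_h f y) = 'D_h u y.
  by apply: near_open Ux => // y Uy; exact: esym (D1_expN h Uy).
have du := derivableP (diff_derivable (v := h) (diff_u Ux)).
have df := derivableP (diff_derivable (v := h) (diff_f1 h Ux)).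
have [_ D] := near_eq_is_derive E (is_derive_opp (is_derive_mul du df)).
rewrite /D2 [LHS]D /D1.
have -> : 'D_h u x = - (u x * 'D_h f x) := D1_expN h Ux.
move: (u x) ('D_h f x) ('D_h ('D_h f) x) => a b c; ring.
Qed.

Lemma D3_expN x h : U x -> D3 u x h =
  u x * (- D1 f x h ^+ 3 + 3 * D1 f x h * D2 f x h - D3 f x h).
Proof.
move=> Ux.
have E : \forall y \near x,
    u y * ('D_h f y * 'D_h f y - 'D_h ('D_h f) y) = 'D_h ('D_h u) y.
  by apply: near_open Ux => // y Uy; exact: esym (D2_expN h Uy).
have du := derivableP (diff_derivable (v := h) (diff_u Ux)).
have df1 := derivableP (diff_derivable (v := h) (diff_f1 h Ux)).
have df2 := derivableP (diff_derivable (v := h) (diff_f2 h Ux)).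
have [_ D] := near_eq_is_derive E
  (is_derive_mul du (is_derive_sub (is_derive_mul df1 df1) df2)).
rewrite /D3 [LHS]D /D2 /D1.
have -> : 'D_h u x = - (u x * 'D_h f x) := D1_expN h Ux.
move: (u x) ('D_h f x) ('D_h ('D_h f) x) ('D_h ('D_h ('D_h f)) x) => a b c d.
ring.
Qed.

Lemma proj_hessE x h : U x -> D2 f x h - D1 f x h ^+ 2 = - D2 u x h / u x.
Proof.
move=> Ux; rewrite D2_expN//; have := expR_gt0 (- f x); rewrite -/(u x).
move: (u x) (D1 f x h) (D2 f x h) => a b c a0.
by field; rewrite gt_eqF.
Qed.

Lemma proj_cubicE x h : U x ->
  D3 f x h - 6 * D2 f x h * D1 f x h + 4 * D1 f x h ^+ 3 =
  - (D3 u x h / u x + 3 * D2 u x h * D1 u x h / u x ^+ 2).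
Proof.
move=> Ux; rewrite D3_expN// D2_expN// D1_expN//.
have := expR_gt0 (- f x); rewrite -/(u x).
move: (u x) (D1 f x h) (D2 f x h) (D3 f x h) => a b c d a0.
by field; rewrite gt_eqF.
Qed.

End ExpTransform.

Lemma derive_eq0_max (R : realType) n (U : set 'rV[R]_n) (g : 'rV[R]_n -> R) c v :
  open U -> U c -> (forall x, U x -> differentiable g x) ->
  (forall x, U x -> g x <= g c) -> 'D_v g c = 0.
Proof.
move=> oU Uc dg gmax.
have /nbhs_ballP[r /= r0 rU] : nbhs c U by exact: open_nbhs_nbhs.
have v10 : 0 < `|v| + 1 by rewrite ltr_pwDr.
pose d := r / (`|v| + 1); have d0 : 0 < d by rewrite divr_gt0.
have inU t : t \in `]-d, d[ -> U (c + t *: v).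
  rewrite in_itv /= -ltr_norml => td; apply: rU; rewrite -ball_normE /=.
  rewrite opprD addNKr normrN normrZ.
  rewrite ltr_pdivlMr// in td; apply: le_lt_trans td.
  by rewrite ler_wpM2l// lerDl.
have d1 t : t \in `]-d, d[ ->
    is_derive t 1 (fun s => g (c + s *: v)) ('D_v g (c + t *: v)).
  by move=> /inU Ut; apply: is_derive_line; apply: diff_derivable; exact: dg.
have z : (0 : R) \in `]-d, d[ by rewrite in_itv /= oppr_lt0 d0.
have K := @derive1_at_max _ (fun s => g (c + s *: v)) (-d) d 0.
have {}K : is_derive (0 : R) 1 (fun s => g (c + s *: v)) 0.
  apply: K => //.
  - by rewrite ltW// gtrN.
  - by move=> t /d1 [].
  - by move=> t /inU Ut; rewrite scale0r addr0; exact: gmax.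
have [_ <-] := K; have [_] := d1 0 z.
by rewrite scale0r addr0 => ->.
Qed.

Section DirectionalSums.
Context {R : realType} {n : nat}.
Implicit Types (U : set 'rV[R]_n) (f : 'rV[R]_n -> R) (x a b v h : 'rV[R]_n).

Lemma is_derive_bigsum (F : 'I_n -> 'rV[R]_n -> R) (dF : 'I_n -> R) x h :
  (forall i, is_derive x h (F i) (dF i)) ->
  is_derive x h (fun y => \sum_i F i y) (\sum_i dF i).
Proof. by move=> H; rewrite -[X in is_derive _ _ X _]fct_sumE; exact: is_derive_sum. Qed.

(** The device by which each duality relation, valid on an open set only, is differentiated. *)
Lemma derive_eq_on U (F G : 'rV[R]_n -> R) x h dF dG : open U -> U x ->
  (forall y, U y -> F y = G y) ->
  is_derive x h F dF -> is_derive x h G dG -> dF = dG.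
Proof.
move=> oU Ux FG HF [_ <-].
by have [_ <-] := near_eq_is_derive (near_open oU FG Ux) HF.
Qed.

Lemma C_on_is_derive k U f x h : C_on k.+1 U f -> U x -> is_derive x h f ('D_h f x).
Proof. by move=> Cf Ux; apply/derivableP/diff_derivable; exact: C_on_diff Cf Ux. Qed.

Lemma derive2_coordE U f x a b : open U -> C_on 2 U f -> U x ->
  'D_a ('D_b f) x = \sum_i b 0 i * 'D_a ('D_(delta_mx 0 i) f) x.
Proof.
move=> oU Cf Ux.
apply: (derive_eq_on (F := 'D_b f)
  (G := fun y => \sum_i b 0 i * 'D_(delta_mx 0 i) f y) oU Ux).
- by move=> y Uy; rewrite derive_coordE//; exact: C_on_diff Cf Uy.
- exact: C_on_is_derive (C_on_derive b Cf) Ux.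
- apply: is_derive_bigsum => i.
  exact: (is_deriveZ (b 0 i) (C_on_is_derive a (C_on_derive (delta_mx 0 i) Cf) Ux)).
Qed.

Lemma derive3_coordE U f x a b c : open U -> C_on 3 U f -> U x ->
  'D_a ('D_b ('D_c f)) x = \sum_i c 0 i * 'D_a ('D_b ('D_(delta_mx 0 i) f)) x.
Proof.
move=> oU Cf Ux; have Cf2 := C_onS Cf.
apply: (derive_eq_on (F := 'D_b ('D_c f))
  (G := fun y => \sum_i c 0 i * 'D_b ('D_(delta_mx 0 i) f) y) oU Ux).
- by move=> y Uy; exact: derive2_coordE oU Cf2 Uy.
- exact: C_on_is_derive (C_on_derive b (C_on_derive c Cf)) Ux.
- apply: is_derive_bigsum => i.
  exact: (is_deriveZ (c 0 i)
    (C_on_is_derive a (C_on_derive b (C_on_derive (delta_mx 0 i) Cf)) Ux)).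
Qed.

End DirectionalSums.

Section DotDerivative.
Context {R : realType} {n : nat}.
Implicit Types (x p v : 'rV[R]_n).

Lemma is_diff_dotl p x : is_diff x (fun y => dot y p) (fun v => dot v p).
Proof.
pose c (y : 'rV[R]_n) := dot y p.
have lc : linear c by move=> a y z; rewrite /c dotDl dotZl.
pose cM := GRing.isLinear.Build _ _ _ _ _ lc.
pose cL : {linear _ -> _} := HB.pack c cM.
have cc : continuous cL by move=> y; exact: dotl_continuous.
by rewrite -/c -[c]/(cL : _ -> _); split; [exact: linear_differentiable|rewrite diff_lin].
Qed.

Lemma is_derive_dotl p x v : is_derive x v (fun y => dot y p) (dot v p).
Proof.
have [d E] := is_diff_dotl p x; split; first exact: diff_derivable.
by rewrite deriveE// E.
Qed.

Lemma is_derive_coord (x : 'rV[R]_n) v i :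
  is_derive x v (fun y : 'rV[R]_n => y 0 i) (v 0 i).
Proof.
have E y : dot y (delta_mx 0 i) = y 0 i.
  rewrite /dot (bigD1 i)//= mxE !eqxx mulr1 big1 ?addr0// => j ji.
  by rewrite mxE (negbTE ji) andbF mulr0.
have := is_derive_dotl (delta_mx 0 i) x v; rewrite E; congr (is_derive _ _ _ _).
by apply/funext => y; rewrite E.
Qed.

End DotDerivative.

(** * Bijectivity and smoothness of the dual map *)

Section DualMap.
Context {R : realType} {n : nat}.
Variables (X : set 'rV[R]_n) (u : 'rV[R]_n -> R).
Hypothesis clX : closed X.
Hypothesis bX : bounded_set X.
Hypothesis cX : convex_set X.
Hypothesis X0 : X° 0.
Hypothesis Cu : C_on 3 X° u.
Hypothesis u_gt0 : forall x, X° x -> 0 < u x.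
Hypothesis D2u_lt0 : forall x h, X° x -> h != 0 -> D2 u x h < 0.
Hypothesis u_boundary : forall y, X y -> ~ X° y -> forall e : R, 0 < e ->
  \forall x \near y, X° x -> u x < e.
Implicit Types (x y p v h : 'rV[R]_n).

Let oX : open X° := @open_interior _ X.
Local Notation Y := ((npolar X)°).
Let oY : open Y := @open_interior _ _.

Let YE p : Y p <-> forall x, X x -> 0 < 1 + dot x p.
Proof. by rewrite interior_npolarE. Qed.

Let tangent_gt := tangent_gt cX Cu D2u_lt0.
Let tangent_gt0 := tangent_gt0 cX Cu u_gt0 D2u_lt0.

(** Value at the origin of the tangent of [u] at [x]; for [u = exp (- f)] it is [u x] times the
    denominator [1 + <f' x, x>] of the map in the theorem. *)
Definition dual_den x := u x - dot x (grad u x).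
Definition dual_map x := (dual_den x)^-1 *: grad u x.

Let diff_u x : X° x -> differentiable u x.
Proof. exact: C_on_diff Cu. Qed.

Lemma dual_den_gt0 x : X° x -> 0 < dual_den x.
Proof.
move=> Xx; have := tangent_gt0 Xx (interior_subset X0).
by rewrite sub0r derive_grad ?dotNl//; exact: diff_u.
Qed.

(** The function [1 + <y, p>] of [y] is the tangent of [u] at [x], scaled to take the value 1 at the
    origin. Tangent inequalities thus become statements about [p]. *)
Lemma dot_dual_map x y : X° x ->
  1 + dot y (dual_map x) = (u x + 'D_(y - x) u x) / dual_den x.
Proof.
move=> Xx; have d0 := dual_den_gt0 Xx.
rewrite derive_grad; last exact: diff_u.
rewrite /dual_map dotZr dotBl; move: d0; rewrite /dual_den.
by move: (u x) (dot x _) (dot y _) => a b c d0; field; rewrite gt_eqF.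
Qed.

Lemma dual_map_interior x : X° x -> Y (dual_map x).
Proof.
move=> Xx; apply/YE => y Xy; rewrite dot_dual_map//.
by rewrite divr_gt0 ?dual_den_gt0 ?tangent_gt0.
Qed.

Lemma dot_dual_map_self x : X° x -> 1 + dot x (dual_map x) = u x / dual_den x.
Proof. by move=> Xx; rewrite dot_dual_map// subrr derive0 addr0. Qed.

(** With denominators cleared: [x] is the only maximiser of [u y / (1 + <y, p>)] for
    [p = dual_map x]. Injectivity follows, as two points with the same image would each beat the
    other. *)
Lemma dual_map_opt x y : X° x -> X° y -> y != x ->
  u y * (1 + dot x (dual_map x)) < u x * (1 + dot y (dual_map x)).
Proof.
move=> Xx Xy yx; rewrite dot_dual_map_self// dot_dual_map// mulrCA ltr_pM2l ?u_gt0//.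
by rewrite ltr_pM2r ?tangent_gt// invr_gt0 dual_den_gt0.
Qed.

Lemma dual_map_inj x y : X° x -> X° y -> dual_map x = dual_map y -> x = y.
Proof.
move=> Xx Xy E; apply/eqP; apply: contraT => xy.
have := dual_map_opt Xy Xx xy.
rewrite eq_sym in xy; have := dual_map_opt Xx Xy xy; rewrite -E.
by move=> H1 H2; have := lt_trans H1 H2; rewrite ltxx.
Qed.

Lemma dual_map_crit x p : X° x -> 0 < 1 + dot x p ->
  (forall v, (1 + dot x p) * 'D_v u x = u x * dot v p) -> dual_map x = p.
Proof.
move=> Xx xp H.
have gE : (1 + dot x p) *: grad u x = u x *: p.
  apply/rowP => i; rewrite !mxE H; congr (_ * _).
  rewrite /dot (bigD1 i)//= mxE !eqxx mul1r big1 ?addr0// => j ji.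
  by rewrite mxE (negbTE ji) andbF mul0r.
(* Stationarity tested in the direction [v = x]. *)
have dE : dual_den x * (1 + dot x p) = u x.
  have := H x; rewrite derive_grad; last exact: diff_u.
  by rewrite /dual_den; move: (dot x p) (dot x _) (u x) => a b c K; rewrite mulrBl; lra.
have d0 := dual_den_gt0 Xx.
apply: (@scalerI _ _ (u x)); first by rewrite gt_eqF// u_gt0.
rewrite -gE /dual_map scalerA -[in LHS]dE mulrAC mulfV ?gt_eqF// mul1r.
by [].
Qed.

(** Extension of [u] by zero, continuous because [u] tends to 0 at the boundary; extremal arguments
    can then run over the compact set [X]. *)
Let ut x := if x \in (X° : set 'rV[R]_n) then u x else 0.

Let ut_continuous : continuous ut.
Proof.
move=> x; have [Xx|nXx] := pselect (X° x).
  have E : \forall y \near x, u y = ut y.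
    by apply: near_open Xx => // y Xy; rewrite /ut mem_set.
  rewrite /continuous_at -(nbhs_singleton E).
  apply: cvg_trans; last exact: (C_on_continuous Cu Xx).
  exact: (@near_eq_cvg _ _ (nbhs x) (nbhs_filter x) u ut E).
have utx : ut x = 0 by rewrite /ut memNset.
rewrite /continuous_at utx.
apply/(cvgrPdist_lt (FF := nbhs_filter x)) => /= e e0.
have [Xx|nX] := pselect (X x).
  apply: filterS (u_boundary Xx nXx e0) => y Hy.
  rewrite sub0r normrN /ut; case: ifPn => [|_]; last by rewrite normr0.
  by rewrite inE => Xy; rewrite gtr0_norm ?u_gt0// Hy.
have : \forall y \near x, (~` X) y.
  by apply: open_nbhs_nbhs; split => //; exact: closed_openC.
apply: filterS => y nXy; rewrite /ut memNset ?subrr ?normr0// => /interior_subset.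
exact: nXy.
Qed.

(** A maximiser of [ut y / (1 + <y, p>)] over [X] is interior, since the quotient is positive at the
    origin and zero on the boundary. *)
Lemma dual_map_surj p : Y p -> exists2 x, X° x & dual_map x = p.
Proof.
move=> /YE Hp.
have [|||c Xc cmax] := @EVT_max_rV R n (fun y => ut y / (1 + dot y p)) X.
- by exists 0; exact: interior_subset.
- exact: bounded_closed_compact.
- apply: continuous_in_subspaceT => y; rewrite inE => Xy.
  have c1 : {for y, continuous (fun y : 'rV[R]_n => 1 + dot y p)}.
    exact: (continuousD (@cst_continuous _ _ (1 : R) y) (@dotl_continuous _ _ p y)).
  have n0 : 1 + dot y p != 0 by rewrite gt_eqF// Hp.
  have c2 : {for y, continuous (fun y : 'rV[R]_n => (1 + dot y p)^-1)}.
    by apply: continuousV.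
  have c0 : {for y, continuous ut} by exact: ut_continuous.
  exact: (continuousM c0 c2).
rewrite inE in Xc.
have utX x : X° x -> ut x = u x by move=> Xx; rewrite /ut mem_set.
have Xic : X° c.
  apply: contrapT => nXc; have := cmax 0; rewrite inE => /(_ (interior_subset X0)).
  rewrite /ut (memNset nXc) mem_set// mul0r dot0l addr0 divr1.
  by rewrite leNgt u_gt0.
exists c => //.
have cp := Hp c Xc.
apply: dual_map_crit => // v.
(* Maximality of the quotient at [c], cross-multiplied: [g] is also maximal at [c], and it is [u] up
   to a factor and a linear term. *)
pose g y := (1 + dot c p) * u y - u c * dot y p.
have dg y : X° y -> differentiable g y.
  move=> Xy; apply: differentiableB; apply: differentiableZ; first exact: diff_u.
  by have [] := is_diff_dotl p y.
have gmax y : X° y -> g y <= g c.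
  move=> Xy; have XXy := interior_subset Xy.
  have := cmax y; rewrite inE => /(_ XXy); rewrite !utX//.
  rewrite ler_pdivrMr ?Hp// mulrAC ler_pdivlMr// /g => K; lra.
have D0 := derive_eq0_max v oX Xic dg gmax.
have du := derivableP (diff_derivable (v := v) (diff_u Xic)).
have [_ D1] := is_derive_sub (is_deriveZ (1 + dot c p) du)
  (is_deriveZ (u c) (is_derive_dotl p c v)).
by apply/eqP; rewrite -subr_eq0 -[X in _ == X]D0 -D1.
Qed.

Lemma C_on_dual_map j : C_on 2 X° (fun x => dual_map x 0 j).
Proof.
have Cg i : C_on 2 X° ('D_(delta_mx 0 i) u) by exact: C_on_derive.
apply: (C_on_ext oX (f := fun x =>
  (u x - \sum_i x 0 i * 'D_(delta_mx 0 i) u x)^-1 * 'D_(delta_mx 0 j) u x)).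
  move=> x _; rewrite [RHS]mxE mxE /dual_den /dot.
  by under [in RHS]eq_bigr do rewrite mxE.
apply: (C_onM oX) => //; apply: (C_onV oX).
  move=> x Xx; have := dual_den_gt0 Xx; rewrite /dual_den /dot.
  by under eq_bigr do rewrite mxE; move=> /gt_eqF ->.
apply: (C_onD oX); first exact: C_onS.
apply: (C_onN oX); apply: (C_on_sum oX) => i.
by apply: (C_onM oX) => //; exact: C_on_coord.
Qed.

(** Let [v] be in the kernel. Differentiating [dual_den p = grad u] along [v] gives [u''[v, .] = - s
    p], where [s = u''[v, x]]. Evaluation at [x] yields [(1 + <x, p>) s = 0], so [s = 0], hence
    [u''[v, v] = 0] and [v = 0]. *)
Lemma dual_map_jac_unit x : X° x -> jacmx dual_map x \in unitmx.
Proof.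
move=> Xx; rewrite -row_free_unit -kermx_eq0; apply/rowV0P => v /sub_kermxP vJ.
have P0 j : is_derive x v (fun y => dual_map y 0 j) 0.
  have CP := C_on_dual_map j; have dP := C_on_is_derive v CP Xx.
  apply: is_derive_eq dP _.
  rewrite derive_coordE; last exact: C_on_diff CP Xx.
  have := congr1 (fun M : 'rV[R]_n => M 0 j) vJ; rewrite /= !mxE => K.
  by rewrite -[RHS]K; apply: eq_bigr => i _; rewrite mxE.
pose e i : 'rV[R]_n := delta_mx 0 i.
pose g i := 'D_(e i) u; pose G i := 'D_v (g i) x.
have dg i : is_derive x v (g i) (G i).
  exact: C_on_is_derive (C_on_derive (e i) Cu) Xx.
pose s := \sum_i x 0 i * G i.
have dd : is_derive x v dual_den (- s).
  have dE : dual_den = fun y => u y - \sum_i y 0 i * g i y.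
    apply/funext => y; rewrite /dual_den /dot; congr (_ - _).
    by apply: eq_bigr => i _; rewrite mxE.
  rewrite dE; have ds := is_derive_bigsum (fun i => is_derive_mul (is_derive_coord x v i) (dg i)).
  apply: is_derive_eq (is_derive_sub (C_on_is_derive v Cu Xx) ds) _.
  rewrite derive_coordE; last exact: diff_u.
  rewrite big_split /= -/s opprD addrCA -sumrB big1 ?addr0// => i _.
  by rewrite mulrC subrr.
have GE j : G j = - (dual_map x 0 j * s).
  have K : forall y, X° y -> dual_map y 0 j * dual_den y = g j y.
    move=> y Xy; rewrite !mxE mulrAC mulVf ?mul1r// gt_eqF//.
    exact: dual_den_gt0.
  have := derive_eq_on oX Xx K (is_derive_mul (P0 j) dd) (dg j).
  by rewrite mulr0 addr0 mulrN.
have s0 : s = 0.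
  have sE : s = - (dot x (dual_map x) * s).
    rewrite {1}/s /dot mulr_suml -sumrN; apply: eq_bigr => i _.
    by rewrite GE mulrN mulrA.
  have /eqP : (1 + dot x (dual_map x)) * s = 0.
    by rewrite mulrDl mul1r {1}sE addNr.
  rewrite mulf_eq0 gt_eqF//; first by move=> /eqP.
  by rewrite dot_dual_map_self// divr_gt0 ?u_gt0 ?dual_den_gt0.
apply/eqP; apply: contraT => v0; have := D2u_lt0 Xx v0.
rewrite /D2 (derive2_coordE _ _ oX (C_onS Cu) Xx) big1 ?ltxx// => i _.
by rewrite -/(e i) -/(g i) -/(G i) GE s0 mulr0 oppr0 mulr0.
Qed.

(** The inverse of [dual_map] on [Y]; elsewhere [get] may return a meaningless point. *)
Definition dual_point p := get [set x | X° x /\ dual_map x = p].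

Lemma dual_pointP p : Y p -> X° (dual_point p) /\ dual_map (dual_point p) = p.
Proof.
move=> Yp; have [x Xx xp] := dual_map_surj Yp.
have E : exists y, [set x | X° x /\ dual_map x = p] y by exists x.
exact: (getPex E).
Qed.

Lemma dual_point_opt p y : Y p -> X° y -> y != dual_point p ->
  u y * (1 + dot (dual_point p) p) < u (dual_point p) * (1 + dot y p).
Proof.
move=> Yp Xy yx; have [Xx E] := dual_pointP Yp.
by have := dual_map_opt Xx Xy yx; rewrite E.
Qed.

(** On the compact set [K] of points of [X] at distance at least [e] from [x0], the strict
    optimality [F (y, p) > 0] of [x0] persists for [q] near [p], uniformly in [y]. A dual point of
    [q] lying in [K] would then be beaten by [x0]. *)
Lemma dual_point_continuous p : Y p -> {for p, continuous dual_point}.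
Proof.
move=> Yp; set x0 := dual_point p; have [Xx0 x0p] := dual_pointP Yp.
apply/(cvgrPdist_lt (FF := nbhs_filter p)) => /= e e0; rewrite -/x0.
pose K := X `\` ball x0 e.
have clK : closed K.
  by rewrite /K setDE; apply: closedI => //; apply: open_closedC; exact: ball_open.
have cK : compact K.
  by apply: subclosed_compact (bounded_closed_compact bX clX) _ => // y [].
have nK : near_covering K by apply/compact_near_coveringP.
pose F (z : 'rV[R]_n * 'rV[R]_n) :=
  u x0 * (1 + dot z.1 z.2) - ut z.1 * (1 + dot x0 z.2).
have H : \forall q \near p, K `<=` (fun y => 0 < F (y, q)).
  apply: (nK _ (nbhs p) (fun q y => 0 < F (y, q)) (nbhs_filter p)) => y [Xy yx0].
  have y0 : 0 < F (y, p).
    rewrite subr_gt0 /=; have [Xiy|nXy] := pselect (X° y).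
      rewrite /ut mem_set//; apply: dual_point_opt => //.
      by apply/eqP => E; apply: yx0; rewrite E; exact: ballxx.
    by rewrite /ut memNset// mul0r mulr_gt0 ?u_gt0//; move/YE: Yp; apply.
  have cF : {for (y, p), continuous F}.
    have c1 : {for (y, p), continuous (fun z : 'rV[R]_n * 'rV[R]_n => z.1)}.
      exact: cvg_fst.
    have c2 : {for (y, p), continuous (fun z : 'rV[R]_n * 'rV[R]_n => z.2)}.
      exact: cvg_snd.
    have c3 : {for (y, p), continuous (fun z : 'rV[R]_n * 'rV[R]_n => ut z.1)}.
      exact: (continuous_comp c1 (@ut_continuous y)).
    have c4 : {for (y, p), continuous (fun z : 'rV[R]_n * 'rV[R]_n => dot x0 z.2)}.
      exact: (continuous_comp c2 (@dotr_continuous _ _ x0 p)).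
    have c5 : {for (y, p), continuous (fun z : 'rV[R]_n * 'rV[R]_n => dot z.1 z.2)}.
      exact: dot_continuous.
    have cc (a : R) : {for (y, p), continuous (fun _ : 'rV[R]_n * 'rV[R]_n => a)}.
      exact: cst_continuous.
    exact: (continuousB (continuousM (cc (u x0)) (continuousD (cc 1) c5))
      (continuousM c3 (continuousD (cc 1) c4))).
  exact: (cvgr_gt (F (y, p)) cF 0 y0).
have HY : \forall q \near p, Y q by apply: open_nbhs_nbhs; split.
apply: filterS2 H HY => q Hq Yq.
have [Xx E] := dual_pointP Yq.
rewrite ltNge; apply/negP => ex.
have Kx : K (dual_point q).
  split; first exact: interior_subset.
  by rewrite -ball_normE /= => xe; move: ex; rewrite leNgt xe.
have := Hq _ Kx; rewrite /F /= subr_gt0 /ut mem_set// => K1.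
have xx : x0 != dual_point q.
  apply/eqP => x0q; case: Kx => _; rewrite -x0q; apply; exact: ballxx.
by have := lt_trans K1 (dual_point_opt Yq Xx0 xx); rewrite ltxx.
Qed.

Lemma C_on_dual_point i : C_on 2 Y (fun p => dual_point p 0 i).
Proof.
apply: (C_on_inverse (U := X°) (P := dual_map)) => //.
- by move=> p /dual_pointP[].
- by move=> p /dual_pointP[].
- move=> j p Yp; have := dual_point_continuous Yp.
  move=> /(@continuous_comp _ _ _ dual_point (fun y : 'rV[R]_n => y 0 j) p); apply.
  exact: coord_continuous.
- exact: C_on_dual_map.
- exact: dual_map_jac_unit.
Qed.

Definition dual_val p := (1 + dot (dual_point p) p) / u (dual_point p).

Definition velocity h p : 'rV[R]_n := \row_i 'D_h (fun q => dual_point q 0 i) p.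

Lemma dual_valM p : Y p -> dual_val p * u (dual_point p) = 1 + dot (dual_point p) p.
Proof.
by move=> Yp; have [Xx _] := dual_pointP Yp; rewrite /dual_val divfK// gt_eqF// u_gt0.
Qed.

Lemma dual_val_gt0 p : Y p -> 0 < dual_val p.
Proof.
move=> Yp; have [Xx _] := dual_pointP Yp; rewrite /dual_val divr_gt0 ?u_gt0//.
by move/YE : Yp; apply; exact: interior_subset.
Qed.

Lemma dual_val_grad p v : Y p -> dual_val p * 'D_v u (dual_point p) = dot v p.
Proof.
move=> Yp; have [Xx E] := dual_pointP Yp.
have -> : dual_val p = (dual_den (dual_point p))^-1.
  rewrite /dual_val -{2}E dot_dual_map_self// mulrAC divff ?mul1r//.
  by rewrite gt_eqF// u_gt0.
by rewrite -[in RHS]E /dual_map dotZr derive_grad//; exact: diff_u.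
Qed.

Lemma dual_point_chain k (F : 'rV[R]_n -> R) p h : C_on k.+1 X° F -> Y p ->
  is_derive p h (fun q => F (dual_point q)) ('D_(velocity h p) F (dual_point p)).
Proof.
move=> CF Yp; have [Xx _] := dual_pointP Yp.
have dQ i : differentiable (fun q => dual_point q 0 i) p.
  exact: C_on_diff (C_on_dual_point i) Yp.
have dF := C_on_diff CF Xx.
split; first by apply: diff_derivable; exact: (differentiable_comp_rV dQ dF).
rewrite (derive_comp_rV h dQ dF) derive_coordE//.
by apply: eq_bigr => i _; rewrite mxE.
Qed.

Lemma dual_point_is_derive p h i : Y p ->
  is_derive p h (fun q => dual_point q 0 i) (velocity h p 0 i).
Proof.
by move=> Yp; rewrite mxE; exact: C_on_is_derive (C_on_dual_point i) Yp.
Qed.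

Lemma dot_dual_point_derive p h : Y p ->
  is_derive p h (fun q => dot (dual_point q) h) (dot (velocity h p) h).
Proof.
move=> Yp; apply: is_derive_bigsum => i.
apply: is_derive_eq (is_derive_mul (dual_point_is_derive h i Yp) (is_derive_cst (h 0 i) p h)) _.
by rewrite mulr0 add0r mulrC.
Qed.

Lemma C_on_dual_val2 : C_on 2 Y dual_val.
Proof.
have CQ := C_on_dual_point.
apply: (C_onM oY).
  apply: (C_onD oY); first exact: C_on_cst.
  apply: (C_on_sum oY) => i; apply: (C_onM oY); first exact: CQ.
  exact: C_on_coord.
apply: (C_onV oY).
  by move=> p /dual_pointP[Xx _]; rewrite gt_eqF// u_gt0.
by apply: (C_on_comp oY oX _ CQ (C_onS Cu)) => p /dual_pointP[].
Qed.

(** Envelope argument: in the derivative of [w u(x) = 1 + <x, p>] the terms carrying the velocity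
    cancel by stationarity. *)
Lemma dual_val_derive p h : Y p ->
  u (dual_point p) * 'D_h dual_val p = dot (dual_point p) h.
Proof.
move=> Yp; have dw := C_on_is_derive h C_on_dual_val2 Yp.
have dU := dual_point_chain h Cu Yp.
have ds : is_derive p h (fun q => 1 + dot (dual_point q) q)
    (0 + \sum_i (dual_point p 0 i * h 0 i + p 0 i * velocity h p 0 i)).
  apply: (is_deriveD (is_derive_cst (1 : R) p h)).
  apply: is_derive_bigsum => i.
  exact: is_derive_mul (dual_point_is_derive h i Yp) (is_derive_coord p h i).
have := derive_eq_on oY Yp (fun q Yq => dual_valM Yq) (is_derive_mul dw dU) ds.
rewrite add0r big_split /= dual_val_grad//.
have -> : \sum_i p 0 i * velocity h p 0 i = dot (velocity h p) p.
  by apply: eq_bigr => i _; rewrite mulrC.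
rewrite -/(dot (dual_point p) h).
move: (dot (dual_point p) h) (dot _ p) (u _) ('D_h dual_val p) => a b c d; lra.
Qed.

(** The first derivative involves [dual_point] but none of its derivatives, so it is C^2 like
    [dual_point]; this gains one order over [C_on_dual_val2]. *)
Lemma C_on_dual_val : C_on 3 Y dual_val.
Proof.
apply: (C_on_intro oY (df := fun h p => dot (dual_point p) h / u (dual_point p))).
- by move=> p; exact: C_on_diff C_on_dual_val2.
- move=> h p Yp; have [Xx _] := dual_pointP Yp.
  by rewrite -dual_val_derive// mulrAC divff ?mul1r// gt_eqF// u_gt0.
- move=> h; apply: (C_onM oY).
    apply: (C_on_sum oY) => i; apply: (C_onM oY); first exact: C_on_dual_point.
    exact: C_on_cst.
  apply: (C_onV oY).
    by move=> p /dual_pointP[Xx _]; rewrite gt_eqF// u_gt0.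
  by apply: (C_on_comp oY oX _ C_on_dual_point (C_onS Cu)) => p /dual_pointP[].
Qed.

Lemma velocity_neq0 p h : Y p -> h != 0 -> velocity h p != 0.
Proof.
move=> Yp; apply: contra => /eqP V0; apply/eqP/rowP => j; rewrite mxE.
have E q : Y q -> dual_map (dual_point q) 0 j = q 0 j.
  by move=> /dual_pointP[_ ->].
have := derive_eq_on oY Yp E (dual_point_chain h (C_on_dual_map j) Yp)
  (is_derive_coord p h j).
by rewrite V0 derive0.
Qed.

(** * Second and third derivatives of the dual value *)

Section ThirdOrder.
Variables (p h : 'rV[R]_n).
Hypothesis Yp : Y p.
Let x := dual_point p.
Let v := velocity h p.
(** The acceleration [x''(p)[h, h]]. It enters both twice-differentiated relations and has to be
    eliminated between them. *)
Let a : 'rV[R]_n := \row_i 'D_h ('D_h (fun q => dual_point q 0 i)) p.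
Let w1 := 'D_h dual_val p.
Let w2 := 'D_h ('D_h dual_val) p.
Let w3 := 'D_h ('D_h ('D_h dual_val)) p.
Let Xx : X° x. Proof. by have [] := dual_pointP Yp. Qed.
Let e i : 'rV[R]_n := delta_mx 0 i.

Let velocity_derive i : is_derive p h (fun q => velocity h q 0 i) (a 0 i).
Proof.
rewrite mxE.
apply: (near_eq_is_derive (f := 'D_h (fun q => dual_point q 0 i))).
  by near=> q; rewrite mxE.
exact: C_on_is_derive (C_on_derive h (C_on_dual_point i)) Yp.
Unshelve. all: by end_near. Qed.

(** The direction [velocity h q] moves with [q], which produces the term in [a]; the expansion in
    coordinates reduces this to the product rule with fixed directions. *)
Let hess_derive i : is_derive p h
  (fun q => 'D_(velocity h q) ('D_(e i) u) (dual_point q))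
  ('D_a ('D_(e i) u) x + 'D_v ('D_v ('D_(e i) u)) x).
Proof.
have Cg : C_on 2 X° ('D_(e i) u) by exact: C_on_derive.
pose F q := \sum_j velocity h q 0 j * 'D_(e j) ('D_(e i) u) (dual_point q).
have FE q : Y q -> F q = 'D_(velocity h q) ('D_(e i) u) (dual_point q).
  by move=> /dual_pointP[Xq _]; rewrite derive_coordE//; exact: C_on_diff Cg Xq.
apply: (near_eq_is_derive (near_open oY FE Yp)).
have dF : is_derive p h F _ := is_derive_bigsum (fun j =>
  is_derive_mul (velocity_derive j) (dual_point_chain h (C_on_derive (e j) Cg) Yp)).
apply: is_derive_eq dF _; rewrite big_split /= addrC; congr (_ + _).
  rewrite derive_coordE; last exact: C_on_diff Cg Xx.
  by apply: eq_bigr => j _; rewrite mulrC.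
exact: esym (derive2_coordE v v oX Cg Xx).
Qed.

Let slope_derive : is_derive p h
  (fun q => 'D_(velocity h q) u (dual_point q)) ('D_a u x + 'D_v ('D_v u) x).
Proof.
pose F q := \sum_j velocity h q 0 j * 'D_(e j) u (dual_point q).
have FE q : Y q -> F q = 'D_(velocity h q) u (dual_point q).
  by move=> /dual_pointP[Xq _]; rewrite derive_coordE//; exact: diff_u.
apply: (near_eq_is_derive (near_open oY FE Yp)).
have dF : is_derive p h F _ := is_derive_bigsum (fun j =>
  is_derive_mul (velocity_derive j) (dual_point_chain h (C_on_derive (e j) Cu) Yp)).
apply: is_derive_eq dF _; rewrite big_split /= addrC; congr (_ + _).
  rewrite derive_coordE; last exact: diff_u.
  by apply: eq_bigr => j _; rewrite mulrC.
exact: esym (derive2_coordE v v oX (C_onS Cu) Xx).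
Qed.

Let dw q : Y q -> is_derive q h dual_val ('D_h dual_val q).
Proof. exact: C_on_is_derive C_on_dual_val. Qed.

Let dw1 : is_derive p h ('D_h dual_val) w2.
Proof. exact: C_on_is_derive (C_on_derive h C_on_dual_val) Yp. Qed.

Let dw2 : is_derive p h ('D_h ('D_h dual_val)) w3.
Proof.
exact: C_on_is_derive (C_on_derive h (C_on_derive h C_on_dual_val)) Yp.
Qed.

Let grad_eq1 i q : Y q ->
  dual_val q * 'D_(velocity h q) ('D_(e i) u) (dual_point q) +
  'D_(e i) u (dual_point q) * 'D_h dual_val q = h 0 i.
Proof.
move=> Yq.
have E r : Y r -> dual_val r * 'D_(e i) u (dual_point r) = r 0 i.
  move=> Yr; rewrite dual_val_grad// dotC /dot (bigD1 i)//= mxE !eqxx mulr1.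
  by rewrite big1 ?addr0// => j ji; rewrite mxE (negbTE ji) andbF mulr0.
exact: (derive_eq_on oY Yq E
  (is_derive_mul (dw Yq) (dual_point_chain h (C_on_derive (e i) Cu) Yq))
  (is_derive_coord q h i)).
Qed.

Let grad_eq2 i :
  dual_val p * ('D_a ('D_(e i) u) x + 'D_v ('D_v ('D_(e i) u)) x)
  + 2 * (w1 * 'D_v ('D_(e i) u) x) + 'D_(e i) u x * w2 = 0.
Proof.
have dg := dual_point_chain h (C_on_derive (e i) Cu) Yp.
have := derive_eq_on oY Yp (fun q Yq => grad_eq1 i Yq)
  (is_deriveD (is_derive_mul (dw Yp) (hess_derive i)) (is_derive_mul dg dw1))
  (is_derive_cst (h 0 i) p h).
rewrite -/w1 -/v -/x.
move: (dual_val p) ('D_a ('D_(e i) u) x + 'D_v ('D_v ('D_(e i) u)) x) w1 w2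
  ('D_v ('D_(e i) u) x) ('D_(e i) u x) => c1 c2 c3 c4 c5 c6 K.
by rewrite -[RHS]K; ring.
Qed.

Let val_eq2 q : Y q -> 'D_h dual_val q * 'D_(velocity h q) u (dual_point q)
  + u (dual_point q) * 'D_h ('D_h dual_val) q = dot (velocity h q) h.
Proof.
move=> Yq; rewrite addrC.
apply: (derive_eq_on oY Yq (fun r Yr => dual_val_derive h Yr) _
  (dot_dual_point_derive h Yq)).
apply: is_derive_mul (dual_point_chain h Cu Yq) _.
exact: C_on_is_derive (C_on_derive h C_on_dual_val) Yq.
Qed.

Let val_eq3 : w1 * ('D_a u x + 'D_v ('D_v u) x) + 2 * ('D_v u x * w2)
  + u x * w3 = dot a h.
Proof.
have da : is_derive p h (fun q => dot (velocity h q) h) (dot a h).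
  apply: is_derive_bigsum => i.
  apply: is_derive_eq (is_derive_mul (velocity_derive i) (is_derive_cst (h 0 i) p h)) _.
  by rewrite mulr0 add0r mulrC.
have := derive_eq_on oY Yp val_eq2
  (is_deriveD (is_derive_mul dw1 slope_derive)
     (is_derive_mul (dual_point_chain h Cu Yp) dw2)) da.
rewrite -/w1 -/w2 -/v -/x.
move: ('D_a u x + 'D_v ('D_v u) x) ('D_v u x) (u x) w1 w2 w3 (dot a h)
  => c1 c2 c3 c4 c5 c6 c7 <-.
ring.
Qed.

(** The relations [grad_eq1] combined with coefficients [b], to be used for the velocity and for the
    acceleration. *)
Let contract1 (b : 'rV[R]_n) :
  dual_val p * 'D_v ('D_b u) x + 'D_b u x * w1 = dot b h.
Proof.
rewrite (derive2_coordE v b oX (C_onS Cu) Xx) derive_coordE; last exact: diff_u.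
rewrite mulr_sumr mulr_suml -big_split /=; apply: eq_bigr => i _.
rewrite -(grad_eq1 i Yp) -/w1 -/v -/x -/(e i).
move: ('D_v ('D_(e i) u) x) ('D_(e i) u x) => c1 c2; ring.
Qed.

(** Two expressions of [<v, h>]: the gradient relation contracted with [v], and the derivative of
    the value relation. *)
Lemma dual_D2 : u x * w2 = dual_val p * 'D_v ('D_v u) x.
Proof.
have := contract1 v; rewrite -(val_eq2 Yp) -/w1 -/w2 -/v -/x.
move: ('D_v u x) ('D_v ('D_v u) x) (u x) => c1 c2 c3 K.
by apply: (@addrI _ (w1 * c1)); rewrite -K; ring.
Qed.

(** [E1] is the second derivative of the gradient relation contracted with [v]. The unknown
    ['D_a ('D_v u) x] in it is removed by [E2] and [E3], which both evaluate [<a, h>]. *)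
Lemma dual_D3 : u x * w3 = - (dual_val p * 'D_v ('D_v ('D_v u)) x
  + 3 * (w1 * 'D_v ('D_v u) x) + 3 * ('D_v u x * w2)).
Proof.
have E1 : dual_val p * ('D_a ('D_v u) x + 'D_v ('D_v ('D_v u)) x)
  + 2 * (w1 * 'D_v ('D_v u) x) + 'D_v u x * w2 = 0.
  rewrite (derive2_coordE a v oX (C_onS Cu) Xx) (derive3_coordE v v v oX Cu Xx).
  rewrite (derive2_coordE v v oX (C_onS Cu) Xx) (@derive_coordE _ _ u); last exact: diff_u.
  rewrite -big_split !mulr_sumr mulr_suml -!big_split /= big1// => i _.
  have := grad_eq2 i; rewrite /e.
  move: ('D_a ('D_(delta_mx 0 i) u) x) ('D_v ('D_v ('D_(delta_mx 0 i) u)) x)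
    ('D_v ('D_(delta_mx 0 i) u) x) ('D_(delta_mx 0 i) u x) => c1 c2 c3 c4 K.
  by rewrite -[RHS](mulr0 (v 0 i)) -K; ring.
have E2 := contract1 a.
(* Symmetry of [u''] identifies the mixed term of [E2] with that of [E1]. *)
rewrite (derive_swap v a oX (C_onS Cu) Xx) in E2.
have E3 := val_eq3.
move: E1 E2 E3.
move: ('D_a ('D_v u) x) ('D_v ('D_v ('D_v u)) x) ('D_v ('D_v u) x) ('D_v u x)
  ('D_a u x) (dual_val p) (u x) w1 w2 w3 (dot a h)
  => c1 c2 c3 c4 c5 c6 c7 d1 d2 d3 c8 E1 E2 E3; nra.
Qed.

End ThirdOrder.

End DualMap.

(** * The dual barrier *)

Lemma derive_ext_on (R : realType) n (U : set 'rV[R]_n) (F G : 'rV[R]_n -> R) v :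
  open U -> (forall x, U x -> F x = G x) ->
  forall x, U x -> 'D_v F x = 'D_v G x.
Proof. by move=> oU FG x Ux; apply: near_eq_derive; exact: (near_open oU FG Ux). Qed.

Lemma is_minimum_unique (R : realType) (A : set R) (a b : R) :
  is_minimum A a -> is_minimum A b -> a = b.
Proof. by move=> [Aa la] [Ab lb]; apply/eqP; rewrite eq_le la//= lb. Qed.

Lemma transform_hess (R : realType) (a b s2 w2 : R) : 0 < a -> 0 < b ->
  a * w2 = b * s2 -> - w2 / b = - s2 / a.
Proof.
move=> a0 b0 E; have a1 : a != 0 by rewrite gt_eqF.
have -> : w2 = b * s2 / a by rewrite -E mulrAC divff// mul1r.
by field; rewrite a1 gt_eqF.
Qed.

(** Because [w2 / b = s2 / a], the terms in [w1] cancel. *)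
Lemma transform_cubic (R : realType) (a b s1 s2 s3 w1 w2 w3 : R) :
  0 < a -> 0 < b -> a * w2 = b * s2 ->
  a * w3 = - (b * s3 + 3 * (w1 * s2) + 3 * (s1 * w2)) ->
  - (w3 / b + 3 * w2 * w1 / b ^+ 2) = s3 / a + 3 * s2 * s1 / a ^+ 2.
Proof.
move=> a0 b0 E2 E3.
have a1 : a != 0 by rewrite gt_eqF.
have b1 : b != 0 by rewrite gt_eqF.
have -> : w3 = - (b * s3 + 3 * (w1 * s2) + 3 * (s1 * w2)) / a.
  by rewrite -E3 mulrAC divff// mul1r.
have -> : w2 = b * s2 / a by rewrite -E2 mulrAC divff// mul1r.
by field; rewrite a1 b1.
Qed.

Section Barrier.
Context {R : realType} {n : nat}.
Variables (X : set 'rV[R]_n) (f : 'rV[R]_n -> R) (gamma : R).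
Hypothesis clX : closed X.
Hypothesis cX : convex_set X.
Hypothesis bX : bounded_set X.
Hypothesis bpX : bounded_set (polar X).
Hypothesis X_neq0 : X° !=set0.
Hypothesis gamma_ge0 : 0 <= gamma.
Hypothesis barrier : psc_barrier_with gamma X f.
Implicit Types (x y p h : 'rV[R]_n).

Let u x := expR (- f x).
Local Notation Y := ((npolar X)°).
Let oX : open X° := @open_interior _ X.
Let oY : open Y := @open_interior _ _.

Let YE p : Y p <-> forall x, X x -> 0 < 1 + dot x p.
Proof. by rewrite interior_npolarE. Qed.

Let X0 : X° 0.
Proof.
apply: interior0_polar_bounded => //.
by have [x Xx] := X_neq0; exists x; exact: interior_subset.
Qed.

Let Cf : C_on 3 X° f. Proof. by case: barrier. Qed.

Let Cu : C_on 3 X° u.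
Proof. by apply: (C_on_exp oX); exact: (C_onN oX Cf). Qed.

Let u_gt0 x : X° x -> 0 < u x. Proof. by move=> _; exact: expR_gt0. Qed.

Let D2u_lt0 x h : X° x -> h != 0 -> D2 u x h < 0.
Proof.
move=> Xx h0; case: barrier => _ /(_ x h Xx h0) + _ _.
rewrite (proj_hessE oX Cf)// -/u pmulr_lgt0 ?oppr_gt0//.
by rewrite invr_gt0 expR_gt0.
Qed.

Let psc_u x h : X° x -> `|D3 u x h / u x + 3 * D2 u x h * D1 u x h / u x ^+ 2|
  <= 2 * gamma * (- D2 u x h / u x) `^ (3 / 2).
Proof.
move=> Xx; case: barrier => _ _ _ /(_ x h Xx).
by rewrite (proj_cubicE oX Cf)// (proj_hessE oX Cf)// normrN.
Qed.

(** The barrier condition is sequential: if the claim failed, points at distance below [1 / (k + 1)]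
    from [y] with [u >= e] would converge to [y] while [f] stays bounded above by [- ln e]. *)
Let u_boundary y : X y -> ~ X° y -> forall e : R, 0 < e ->
  \forall x \near y, X° x -> u x < e.
Proof.
move=> Xy nXy e e0; apply: contrapT => nH.
have ex k : exists x, [/\ X° x, e <= u x & `|y - x| < k.+1%:R^-1].
  apply: contrapT => nex; apply: nH.
  apply/nbhs_ballP; exists k.+1%:R^-1; first by rewrite /= invr_gt0.
  move=> x; rewrite -ball_normE /= => xk Xx; rewrite ltNge; apply/negP => ux.
  by apply: nex; exists x.
have [x_ Hx] := choice ex.
have cx : x_ k @[k --> \oo] --> y.
  apply/cvgrPdist_lt => d d0; near=> k.
  have [_ _ /lt_trans] := Hx k; apply; near: k.
  exact: (near_infty_natSinv_lt (PosNum d0)).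
have Xx_ k : X° (x_ k) by have [] := Hx k.
have by_ : boundary X y by split=> //; exact: subset_closure.
case: barrier => _ _ /(_ x_ y Xx_ by_ cx) /cvgryPgt /(_ (- ln e)) H _.
have [k] : exists k, - ln e < f (x_ k) by exact: (filter_ex H).
have [_ ek _] := Hx k; rewrite ltNge => /negP; apply.
by rewrite lerNr -[leRHS]expRK ler_ln ?posrE ?expR_gt0.
Unshelve. all: by end_near. Qed.

Let pointP p : Y p -> X° (dual_point X u p) /\ dual_map u (dual_point X u p) = p.
Proof. exact: dual_pointP. Qed.

Let w := dual_val X u.

Let w_gt0 p : Y p -> 0 < w p. Proof. exact: dual_val_gt0. Qed.

Let w_le p y : Y p -> X° y -> w p <= (1 + dot y p) / u y.
Proof.
move=> Yp Xy; have [Xx _] := pointP Yp.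
have [->|yx] := eqVneq y (dual_point X u p); first exact: lexx.
rewrite ler_pdivlMr ?u_gt0// mulrAC ler_pdivrMr ?u_gt0// mulrC [leRHS]mulrC ltW//.
exact: (dual_point_opt clX bX cX X0 Cu u_gt0 D2u_lt0 u_boundary).
Qed.

Let dual_qE p x : Y p -> X° x -> dual_q f p x = ln ((1 + dot x p) / u x).
Proof.
move=> Yp Xx; rewrite lnM ?posrE ?invr_gt0 ?u_gt0//; last first.
  by move/YE: Yp; apply; exact: interior_subset.
by rewrite lnV ?posrE ?u_gt0// expRK opprK addrC.
Qed.

Let min_q p : Y p -> is_minimum (dual_q f p @` X°) (ln (w p)).
Proof.
move=> Yp; have [Xx _] := pointP Yp; split.
  by exists (dual_point X u p) => //; rewrite dual_qE.
move=> _ [y Xy <-]; rewrite dual_qE// ler_ln ?posrE ?w_gt0 ?w_le//.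
by rewrite divr_gt0 ?u_gt0//; move/YE: Yp; apply; exact: interior_subset.
Qed.

Let dual_funE p : Y p -> dual_fun X f p = - ln (w p).
Proof.
move=> Yp; congr (- _); apply: is_minimum_unique (min_q Yp).
by apply: getPex; exists (ln (w p)); exact: min_q.
Qed.

Lemma dual_fun_min p : Y p ->
  is_minimum (dual_q f p @` X°) (- dual_fun X f p).
Proof. by move=> Yp; rewrite dual_funE// opprK; exact: min_q. Qed.

Lemma interior_dual_dom p : Y p -> dual_dom X f p.
Proof.
move=> Yp; have [Xx _] := pointP Yp; have /YE Hp := Yp.
split=> [x Xx'|]; first by apply: Hp; exact: interior_subset.
exists (dual_point X u p) => //.
have dq x : X° x -> differentiable (dual_q f p) x.
  move=> Xx'; apply: differentiableD; first exact: C_on_diff Cf Xx'.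
  apply: (differentiable_comp1 (f := fun x => 1 + dot x p) (g := @ln R)).
    apply: differentiableD; first exact: differentiable_cst.
    by have [] := is_diff_dotl p x.
  by apply: is_derive1_ln; apply: Hp; exact: interior_subset.
split; first exact: dq.
apply/funext => v; rewrite -deriveE; last exact: dq.
have gmax x : X° x -> (- dual_q f p) x <= (- dual_q f p) (dual_point X u p).
  move=> Xx'; rewrite !fctE lerN2 !dual_qE//.
  have [_] := min_q Yp; apply; exists x => //.
  exact: dual_qE.
have := derive_eq0_max v oX Xx (fun x Xx' => differentiableN (dq x Xx')) gmax.
rewrite deriveN; last by apply: diff_derivable; exact: dq.
by move=> /eqP; rewrite oppr_eq0 => /eqP.
Qed.

Let Cw : C_on 3 Y w.
Proof. exact: C_on_dual_val. Qed.

Lemma C_on_dual_fun : C_on 3 Y (dual_fun X f).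
Proof.
apply: (C_on_ext oY (f := fun p => - ln (w p))).
  by move=> p Yp; rewrite dual_funE.
by apply: (C_onN oY); exact: (C_on_ln oY w_gt0 Cw).
Qed.

Let wE p : Y p -> expR (- dual_fun X f p) = w p.
Proof. by move=> Yp; rewrite dual_funE// opprK lnK// posrE w_gt0. Qed.

(** [wE] holds on an open set and may be differentiated; each of these three identities is the one
    that the next differentiates. *)
Let D1w h p : Y p -> D1 (fun p => expR (- dual_fun X f p)) p h = D1 w p h.
Proof. exact: derive_ext_on oY wE p. Qed.

Let D2w h p : Y p -> D2 (fun p => expR (- dual_fun X f p)) p h = D2 w p h.
Proof. exact: derive_ext_on oY (D1w h) p. Qed.

Let D3w h p : Y p -> D3 (fun p => expR (- dual_fun X f p)) p h = D3 w p h.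
Proof. exact: derive_ext_on oY (D2w h) p. Qed.

Let hess_w h p : Y p -> D2 (dual_fun X f) p h - D1 (dual_fun X f) p h ^+ 2 =
  - D2 u (dual_point X u p) (velocity X u h p) / u (dual_point X u p).
Proof.
move=> Yp; have [Xx _] := pointP Yp.
rewrite (proj_hessE oY C_on_dual_fun)// D2w// wE//.
exact: (transform_hess (u_gt0 Xx) (w_gt0 Yp)
  (dual_D2 clX bX cX X0 Cu u_gt0 D2u_lt0 u_boundary h Yp)).
Qed.

Let cubic_w h p : Y p ->
  D3 (dual_fun X f) p h - 6 * D2 (dual_fun X f) p h * D1 (dual_fun X f) p h
    + 4 * D1 (dual_fun X f) p h ^+ 3 =
  D3 u (dual_point X u p) (velocity X u h p) / u (dual_point X u p) +
  3 * D2 u (dual_point X u p) (velocity X u h p) *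
    D1 u (dual_point X u p) (velocity X u h p) / u (dual_point X u p) ^+ 2.
Proof.
move=> Yp; have [Xx _] := pointP Yp.
rewrite (proj_cubicE oY C_on_dual_fun)// D1w// D2w// D3w// wE//.
exact: (transform_cubic (u_gt0 Xx) (w_gt0 Yp)
  (dual_D2 clX bX cX X0 Cu u_gt0 D2u_lt0 u_boundary h Yp)
  (dual_D3 clX bX cX X0 Cu u_gt0 D2u_lt0 u_boundary h Yp)).
Qed.

(** One fixed point [z] of the segment from 0 to the contact point [y] suffices for a given level:
    [w (p_ k)] is at most [(1 + <z, p_ k>) / u z], which converges to [(1 - t) / u z]. *)
Lemma dual_fun_boundary (p_ : nat -> 'rV[R]_n) p : (forall k, Y (p_ k)) ->
  boundary (npolar X) p -> p_ k @[k --> \oo] --> p ->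
  dual_fun X f (p_ k) @[k --> \oo] --> +oo%R.
Proof.
move=> Yp_ [+ nYp] cp; have [clY _ _ _] := regular_convex_npolar clX bX bpX.
rewrite -((closure_id _).1 clY) npolarE => Hp.
have [y Xy yp] : exists2 y, X y & 1 + dot y p = 0.
  apply: contrapT => nex; apply: nYp; apply/YE => x Xx.
  rewrite lt_neqAle Hp// andbT eq_sym; apply/eqP => xp.
  by apply: nex; exists x.
have y0 : y != 0.
  apply/eqP => y0; move: yp; rewrite y0 dot0l addr0 => /eqP.
  by rewrite oner_eq0.
apply/cvgryPgt => A.
(* Slope [exp A], so that [(1 - t) / u z < exp (- A)], which is the level [A] for the dual
   function. *)
have [t t01] := slope_unbounded cX Cu u_gt0 D2u_lt0 gamma_ge0 (expR_gt0 A)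
  psc_u X0 Xy y0.
have Xz := interior_segment cX X0 Xy t01.
move: Xz; rewrite subr0 add0r; set z := t *: y => Xz Az.
have zp : (1 + dot z p) / u z < expR (- A).
  have -> : 1 + dot z p = 1 - t by rewrite dotZl; move: yp; move: (dot y p) => b; nra.
  by rewrite ltr_pdivrMr ?u_gt0// expRN ltr_pdivlMl ?expR_gt0.
have c : (1 + dot z (p_ k)) / u z @[k --> \oo] --> (1 + dot z p) / u z.
  have c1 : {for p, continuous (fun q => 1 + dot z q)}.
    exact: (continuousD (@cst_continuous _ _ (1 : R) p) (@dotr_continuous _ _ z p)).
  have c2 : {for p, continuous (fun q => (1 + dot z q) / u z)}.
    exact: (continuousM c1 (@cst_continuous _ _ (u z)^-1 p)).
  exact: (cvg_comp _ _ cp c2).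
have H := cvgr_lt _ c _ zp; near=> k.
have Hk : (1 + dot z (p_ k)) / u z < expR (- A) by near: k; exact: H.
rewrite dual_funE// ltrNr -[ltRHS]expRK ltr_ln ?posrE ?expR_gt0 ?w_gt0//.
by rewrite (le_lt_trans (w_le (Yp_ k) Xz)).
Unshelve. all: by end_near. Qed.

Lemma dual_fun_barrier : psc_barrier_with gamma (npolar X) (dual_fun X f).
Proof.
split.
- exact: C_on_dual_fun.
- move=> p h Yp h0; have [Xx _] := pointP Yp.
  rewrite hess_w// divr_gt0 ?u_gt0// oppr_gt0 D2u_lt0//.
  exact: (velocity_neq0 clX bX cX X0 Cu u_gt0 D2u_lt0 u_boundary).
- exact: dual_fun_boundary.
- move=> p h Yp; have [Xx _] := pointP Yp.
  rewrite (cubic_w h Yp).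
  rewrite (hess_w h Yp).
  exact: (psc_u (velocity X u h p) Xx).
Qed.

Let gradE x : X° x -> grad u x = - (u x *: grad f x).
Proof.
by move=> Xx; apply/rowP => i; rewrite !mxE; exact: (D1_expN Cf (delta_mx 0 i) Xx).
Qed.

Let dual_denE x : X° x -> dual_den u x = u x * (1 + dot (grad f x) x).
Proof.
move=> Xx; rewrite /dual_den gradE// dotNr dotZr opprK mulrDr mulr1.
by rewrite dotC.
Qed.

Lemma map_denominator_neq0 x : X° x -> 1 + dot (grad f x) x != 0.
Proof.
move=> Xx; have := dual_den_gt0 cX X0 Cu u_gt0 D2u_lt0 Xx.
by rewrite dual_denE// pmulr_rgt0 ?u_gt0// => /gt_eqF ->.
Qed.

Lemma map_bij :
  set_bij X° Y (fun x => - ((1 + dot (grad f x) x)^-1 *: grad f x)).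
Proof.
have E x : X° x ->
    - ((1 + dot (grad f x) x)^-1 *: grad f x) = dual_map u x.
  move=> Xx; rewrite /dual_map dual_denE// gradE// scalerN scalerA.
  by rewrite invfM mulrAC mulVf ?mul1r// gt_eqF// u_gt0.
split.
- by move=> x Xx; rewrite /= E//; exact: dual_map_interior.
- move=> x y; rewrite !inE => Xx Xy; rewrite /= !E//.
  exact: (dual_map_inj cX X0 Cu u_gt0 D2u_lt0).
- move=> p Yp; have [Xx xp] := pointP Yp; exists (dual_point X u p) => //=.
  by rewrite E.
Qed.

End Barrier.

Theorem theorem5p6 (R : realType) (n : nat) (X : set 'rV[R]_n)
    (f : 'rV[R]_n -> R)
    (hX : regular_convex X)
    (bX : bounded_set X)
    (bXpolar : bounded_set (polar X))
    (hf : psc_barrier X f) :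
  let mXpolar := -%R @` polar X in
  [/\ (* the dual function is defined on the interior of the negated polar *)
      forall p, mXpolar° p ->
        dual_dom X f p /\ is_minimum (dual_q f p @` X°) (- dual_fun X f p),
      psc_barrier mXpolar (dual_fun X f),
      (* the denominator of the map does not vanish *)
      forall x, X° x -> 1 + dot (grad f x) x != 0 &
      set_bij X° mXpolar° (fun x => - ((1 + dot (grad f x) x)^-1 *: grad f x))].
Proof.
move=> mXpolar; have [clX cX X_neq0 _] := hX; have [_ [gamma g0 hfg]] := hf.
split.
- move=> p Yp; split.
    exact: (interior_dual_dom clX cX bX bXpolar X_neq0 hfg).
  exact: (dual_fun_min clX cX bX bXpolar X_neq0 hfg).
- split; first exact: regular_convex_npolar.
  by exists gamma => //; exact: dual_fun_barrier.
- exact: (map_denominator_neq0 clX cX bX bXpolar X_neq0 hfg).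
- exact: (map_bij clX cX bX bXpolar X_neq0 hfg).
Qed.
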